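(* Let $p_1\equiv 1\pmod 8$ and $p_2\equiv 1\pmod 4$ be distinct primes with $N(\varepsilon_{p_1p_2})=N(\varepsilon_{2p_1p_2})=-1$. Put $n_1=N(\varepsilon_{2p_1})$, $n_2=N(\varepsilon_{2p_2})$, $\mathbb{K}=\mathbb{Q}(\sqrt2,\sqrt{p_1},\sqrt{p_2})$ and $k_3=\mathbb{Q}(\sqrt2,\sqrt{p_1p_2})$. 1) If $n_1=n_2=-1$, then $E_{\mathbb{K}}$ takes one of the forms (a) $\langle -1, \varepsilon_{2}, \varepsilon_{p_1}, \varepsilon_{p_2}, \sqrt{\varepsilon_{2}\varepsilon_{p_1}\varepsilon_{2p_1}}, \sqrt{\varepsilon_{2}\varepsilon_{p_2}\varepsilon_{2p_2}}, \sqrt{\varepsilon_{2}\varepsilon_{p_1p_2}\varepsilon_{2p_1p_2}},\sqrt{\varepsilon_{p_1}\varepsilon_{p_2}\varepsilon_{p_1p_2}}\rangle$, or (b) $\langle -1, \varepsilon_{2}, \varepsilon_{p_1},\varepsilon_{p_2}, \sqrt{\varepsilon_{2}\varepsilon_{p_1}\varepsilon_{2p_1}},\sqrt{\varepsilon_{2}\varepsilon_{p_2}\varepsilon_{2p_2}}, \sqrt{\varepsilon_{p_1}\varepsilon_{p_2}\varepsilon_{p_1p_2}}, \sqrt{\varepsilon_{2}^a\varepsilon_{p_1}^b \varepsilon_{p_2}^c \varepsilon_{p_1p_2}^d \sqrt{\varepsilon_{2}\varepsilon_{p_1}\varepsilon_{2p_1}}\sqrt{\varepsilon_{2}\varepsilon_{p_2}\varepsilon_{2p_2}}\sqrt{\varepsilon_{2}\varepsilon_{p_1p_2}\varepsilon_{2p_1p_2}}}\rangle$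 for some $a,b,c,d\in\{0,1\}$ with $(b,c,d)\neq(1,1,1)$. Furthermore, if $E_{\mathbb{K}}$ takes form (b), then $\varepsilon_{2}\varepsilon_{p_1p_2}\varepsilon_{2p_1p_2}$ is a square in $k_3$. 2) If $(n_1,n_2)=(-1,1)$, then $E_{\mathbb{K}}=\langle-1, \varepsilon_{2}, \varepsilon_{p_1},\varepsilon_{p_2},\sqrt{\varepsilon_{2p_2}}, \sqrt{\varepsilon_{2}\varepsilon_{p_1}\varepsilon_{2p_1}},\sqrt{\varepsilon_2\varepsilon_{p_1p_2}\varepsilon_{2p_1p_2}}, \sqrt{\varepsilon_{p_1}\varepsilon_{p_2}\varepsilon_{p_1p_2}}\rangle$. 3) If $(n_1,n_2)=(1,1)$, then $E_{\mathbb{K}}=\langle-1, \varepsilon_{2}, \varepsilon_{p_1},\varepsilon_{p_2},\sqrt{\varepsilon_{2p_1}},\sqrt{\varepsilon_{2p_2}}, \sqrt{\varepsilon_{2}\varepsilon_{p_1p_2}\varepsilon_{2p_1p_2}}, \sqrt{\varepsilon_{p_1}\varepsilon_{p_2}\varepsilon_{p_1p_2}}\rangle$.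
   Context: For a square-free integer $d>1$, $\varepsilon_d$ denotes the fundamental unit ($>1$) of $\mathbb{Q}(\sqrt d)$ and $N(\varepsilon_d)$ its norm to $\mathbb{Q}$. $E_{\mathbb{K}}$ is the unit group of $\mathbb{K}$; square roots are (suitably chosen) square roots lying in $\mathbb{K}$. *)

(* Defs.v *)
From HB Require Import structures.
From mathcomp Require Import all_boot all_order all_algebra all_field.

Set Implicit Arguments.
Unset Strict Implicit.
Unset Printing Implicit Defensive.

Import Order.TTheory GRing.Theory Num.Theory.
Local Open Scope ring_scope.

(* Number fields are subfields of algC, given by their membership predicates.
   On nonnegative reals sqrtC is the nonnegative square root. *)

Definition square_free (d : nat) : Prop :=
  forall m : nat, (m ^ 2 %| d)%N -> m = 1%N.

Definition sqrt_nat (d : nat) : algC := sqrtC d%:R.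

(* The field Q(s), i.e. the smallest subfield of algC containing s. *)
Inductive Qadjoin (s : seq algC) : algC -> Prop :=
| Qadjoin_gen x : x \in s -> Qadjoin s x
| Qadjoin_one : Qadjoin s 1
| Qadjoin_sub x y : Qadjoin s x -> Qadjoin s y -> Qadjoin s (x - y)
| Qadjoin_div x y : Qadjoin s x -> Qadjoin s y -> Qadjoin s (x / y).

(* The subgroup of the multiplicative group of algC generated by s; it is
   only meaningful when every element of s is nonzero. *)
Inductive mul_span (s : seq algC) : algC -> Prop :=
| mul_span_gen x : x \in s -> mul_span s x
| mul_span_one : mul_span s 1
| mul_span_div x y : mul_span s x -> mul_span s y -> mul_span s (x / y).

Definition int_ring (K : algC -> Prop) (x : algC) : Prop :=
  K x /\ x \in Aint.

Definition unit_group (K : algC -> Prop) (u : algC) : Prop :=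
  int_ring K u /\ exists2 v : algC, int_ring K v & u * v = 1.

Definition units_are (K : algC -> Prop) (s : seq algC) : Prop :=
  forall u : algC, unit_group K u <-> mul_span s u.

Definition is_square_in (K : algC -> Prop) (x : algC) : Prop :=
  exists2 y : algC, K y & x = y ^+ 2.

Definition Qsqrt (d : nat) : algC -> Prop := Qadjoin [:: sqrt_nat d].

(* For d > 1 square-free there is exactly one such e. *)
Definition fundamental_unit (d : nat) (e : algC) : Prop :=
  1 < e /\ units_are (Qsqrt d) [:: -1; e].

(* n is the norm of z from Q(sqrt d) to Q (for d > 1 square-free). *)
Definition quad_norm (d : nat) (z : algC) (n : rat) : Prop :=
  exists x y : rat,
    z = ratr x + ratr y * sqrt_nat d /\ n = x ^+ 2 - d%:R * y ^+ 2.

(* Main.v *)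
(** Let [G] be the Galois group of [K/Q], with [K = Q(sqrt 2, sqrt p1, sqrt p2)].

    Squares. If [e1, e2, e3] are the fundamental units, all of norm -1, of the
    quadratic subfields of a biquadratic field, and [eta = e1 e2 e3], then
    [b = eta + e1 + e2 - e3] satisfies [g (b ^ 2 / eta) = b ^ 2 / eta] for all
    [g] in [G], so that [m eta] is a square for a positive integer [m]. Likewise
    [m e = (e + 1) ^ 2] if [e] has norm 1. A prime which is unramified in [K]
    divides such an [m] to an even power, and the ramified primes are squares
    in [K]; hence [eta] (resp. [e]) is a square in [K]. The same argument in
    [Q(sqrt p)], where 2 is unramified, shows that the fundamental unit has norm
    -1 when [p = 1 mod 4].

    Units. For a unit [u] of [K], [u ^ 2] is a quotient of relative norms to the
    three biquadratic subfields containing [sqrt 2]. The units of these are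
    determined by the signs of their conjugates, so that, up to known units,
    [u ^ 2 = e2^a ep1^b ep2^c ep1p2^d W1^i W2^j W3^k] with exponents 0 or 1 and
    [W1, W2, W3] the square roots found above. Taking relative norms once more
    and using that [e2] is not a square in [K] gives [i = j = k], and these
    vanish unless [n1 = n2 = -1]; signs then force [a = 0] and [b = c = d] in the
    case [i = j = k = 0]. *)

Require Import Defs.
From HB Require Import structures.
From mathcomp Require Import all_boot all_order all_algebra all_field.
From mathcomp Require Import ring.
From Stdlib Require Import Classical_Prop.
Import Order.TTheory GRing.Theory Num.Theory.
Local Open Scope ring_scope.

Set Implicit Arguments.
Unset Strict Implicit.
Unset Printing Implicit Defensive.

(** * Subfields of algC and their automorphisms *)

Definition subfield_pred (k : algC -> Prop) : Prop :=
  [/\ k 1, forall x y, k x -> k y -> k (x - y)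
         & forall x y, k x -> k y -> k (x / y)].

Section SubfieldTheory.
Variables (k : algC -> Prop) (kF : subfield_pred k).

Lemma subfield1 : k 1. Proof. by case: kF. Qed.
Lemma subfieldB x y : k x -> k y -> k (x - y). Proof. by case: kF => _ + _; apply. Qed.
Lemma subfield_div x y : k x -> k y -> k (x / y). Proof. by case: kF => _ _; apply. Qed.
Lemma subfield0 : k 0. Proof. by rewrite -(subrr 1); apply: subfieldB subfield1 subfield1. Qed.
Lemma subfieldN x : k x -> k (- x). Proof. by rewrite -sub0r; apply: subfieldB subfield0. Qed.
Lemma subfieldD x y : k x -> k y -> k (x + y).
Proof. by move=> kx ky; rewrite -[y]opprK; apply: subfieldB => //; apply: subfieldN. Qed.
Lemma subfieldV x : k x -> k x^-1. Proof. by rewrite -div1r; apply: subfield_div subfield1. Qed.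
Lemma subfieldM x y : k x -> k y -> k (x * y).
Proof. by move=> kx ky; rewrite -[y]invrK; apply: subfield_div => //; apply: subfieldV. Qed.
Lemma subfieldX n x : k x -> k (x ^+ n).
Proof.
move=> kx; elim: n => [|n IHn]; first exact: subfield1.
by rewrite exprS; apply: subfieldM.
Qed.
Lemma subfield_nat n : k n%:R.
Proof.
elim: n => [|n IHn]; first exact: subfield0.
by rewrite -natr1; apply: subfieldD subfield1.
Qed.
Lemma subfield_Crat x : x \in Crat -> k x.
Proof.
have kz (z : int) : k z%:~R.
  by case: z => n; [apply: subfield_nat | apply/subfieldN/subfield_nat].
case/CratP=> a ->; rewrite -(divq_num_den a) fmorph_div /= !ratr_int.
exact: subfield_div.
Qed.

End SubfieldTheory.

Lemma subfield_Qadjoin s : subfield_pred (Qadjoin s).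
Proof. by split=> [|x y|x y]; [apply: Qadjoin_one | apply: Qadjoin_sub | apply: Qadjoin_div]. Qed.

Lemma Qadjoin_min (k : algC -> Prop) s x :
  subfield_pred k -> (forall y, y \in s -> k y) -> Qadjoin s x -> k x.
Proof.
move=> kF sk; elim=> [y /sk //||y z _ ky _ kz|y z _ ky _ kz].
- exact: subfield1.
- exact: subfieldB.
- exact: subfield_div.
Qed.

Lemma subfield_rat : subfield_pred (fun z => z \in Crat).
Proof. by split=> [|x y|x y]; [apply: rpred1 | apply: rpredB | apply: rpred_div]. Qed.

Lemma subfield_real : subfield_pred (fun z => z \is Num.real).
Proof. by split=> [|x y|x y]; [apply: rpred1 | apply: rpredB | apply: rpred_div]. Qed.

(** When [s ^+ 2] lies in [k] this is the field [k(s)]. Unlike [Qadjoin], it provides coordinates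
    over [k]. *)
Definition adj (k : algC -> Prop) (s z : algC) : Prop :=
  exists x y, [/\ k x, k y & z = x + y * s].

Lemma adj_base k s z : subfield_pred k -> k z -> adj k s z.
Proof. by move=> kF kz; exists z, 0; split=> //; [apply: subfield0 | rewrite mul0r addr0]. Qed.

Lemma adj_gen k s : subfield_pred k -> adj k s s.
Proof.
by move=> kF; exists 0, 1; split; [apply: subfield0|apply: subfield1|rewrite mul1r add0r].
Qed.

Lemma adj_sub k k' s z : subfield_pred k' -> (forall x, k x -> k' x) -> k' s ->
  adj k s z -> k' z.
Proof.
move=> kF' kk' ks [x [y [kx ky ->]]].
by apply: subfieldD => //; [apply: kk' | apply: subfieldM => //; apply: kk'].
Qed.

(** An inverse is obtained by multiplying with the conjugate [z - t * s]. If the norm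
    [z ^+ 2 - t ^+ 2 * s ^+ 2] vanishes, then [t = 0], since otherwise [s] would be [z / t] up to
    sign and lie in [k]; that degenerate case is settled first. *)
Lemma subfield_adj k s : subfield_pred k -> k (s ^+ 2) -> subfield_pred (adj k s).
Proof.
move=> kF ks2; case: (classic (k s)) => [ks | nks].
  have adjE z : adj k s z <-> k z.
    by split=> [|kz]; [apply: adj_sub | apply: adj_base].
  split=> [|x y|x y]; rewrite !adjE; [exact: subfield1 | exact: subfieldB | exact: subfield_div].
split=> [|_ _ [x [y [kx ky ->]]] [z [t [kz kt ->]]]|].
- by apply: adj_base => //; apply: subfield1.
- by exists (x - z), (y - t); split; [exact: subfieldB | exact: subfieldB | ring].
move=> _ _ [x [y [kx ky ->]]] [z [t [kz kt ->]]].
have [nz|/eqP] := boolP (z ^+ 2 - t ^+ 2 * s ^+ 2 == 0).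
  have t0 : t = 0.
    apply/eqP/negPn/negP=> t_neq0; apply: nks.
    have /orP[/eqP zt | /eqP zt] : (z == t * s) || (z == - (t * s)).
      by rewrite -eqf_sqr exprMn -subr_eq0.
    - have -> : s = z / t by rewrite zt mulrC mulKf.
      exact: subfield_div.
    - have -> : s = - z / t by rewrite zt opprK mulrC mulKf.
      by apply: subfield_div => //; apply: subfieldN.
  have z0 : z = 0.
    by move: nz; rewrite t0 expr0n /= mul0r subr0 sqrf_eq0 => /eqP.
  rewrite t0 z0 mul0r addr0 invr0 mulr0; by apply: adj_base => //; apply: subfield0.
move/eqP=> nz; set N := _ - _ in nz.
have kN : k N by apply: subfieldB => //; [|apply: subfieldM => //]; apply: subfieldX.
exists ((x * z - y * t * s ^+ 2) / N), ((y * z - x * t) / N); split.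
- apply: subfield_div => //; apply: subfieldB => //; first exact: subfieldM.
  by do 2! apply: subfieldM => //.
- by apply: subfield_div => //; apply: subfieldB => //; exact: subfieldM.
have NE : N = (z + t * s) * (z - t * s) by rewrite /N; ring.
have /andP[n1 n2] : (z + t * s != 0) && (z - t * s != 0) by rewrite -negb_or -mulf_eq0 -NE.
rewrite NE; field; by rewrite n1 n2.
Qed.

(** With [z = x + y * s], the cross term [2 x y s] of [z ^+ 2] lies in [k]. Hence [x = 0], or
    [y = 0], or [s] itself is in [k]. *)
Lemma adj_sqr k s z : subfield_pred k -> k (s ^+ 2) -> adj k s z -> k (z ^+ 2) ->
  k z \/ k (z * s).
Proof.
move=> kF ks2 [x [y [kx ky zE]]] kz2.
have [y0|y0] := eqVneq y 0; first by left; rewrite zE y0 mul0r addr0.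
have [x0|x0] := eqVneq x 0.
  by right; rewrite zE x0 add0r -mulrA -expr2; apply: subfieldM.
left; rewrite zE; apply: subfieldD => //; apply: subfieldM => //.
have -> : s = (z ^+ 2 - x ^+ 2 - y ^+ 2 * s ^+ 2) / (2%:R * x * y).
  by rewrite zE; field; rewrite x0 y0.
apply: subfield_div => //.
  by apply: subfieldB => //; [apply: subfieldB => //|apply: subfieldM => //]; apply: subfieldX.
by apply: subfieldM => //; apply: subfieldM => //; apply: subfield_nat.
Qed.

(** Transports membership from an abstract number field, where Galois theory is available, to
    [algC]. By induction on the generators, an element is a polynomial in the last one. *)
Lemma mem_adjoin_seq (L : fieldExtType rat) (iota : {rmorphism L -> algC}) rs x :
  x \in <<1 & rs>>%VS -> Qadjoin (map iota rs) (iota x).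
Proof.
elim/last_ind: rs x => [|rs a IHrs] x.
  rewrite /= Fadjoin_nil => /vlineP[c ->].
  apply: (subfield_Crat (subfield_Qadjoin _)).
  by rewrite rmorphZ_num rmorph1 mulr1 Crat_rat.
rewrite adjoin_rcons => /Fadjoin_polyP[p /polyOverP p_over ->].
have F := subfield_Qadjoin (map iota (rcons rs a)).
have sub y : Qadjoin (map iota rs) y -> Qadjoin (map iota (rcons rs a)) y.
  apply: Qadjoin_min => // z z_rs; apply: Qadjoin_gen.
  by rewrite map_rcons mem_rcons inE z_rs orbT.
rewrite horner_coef rmorph_sum /=.
elim/big_ind: _ => [||i _]; first exact: subfield0.
  exact: subfieldD.
rewrite rmorphM rmorphXn /=; apply: subfieldM => //.
  by apply/sub/IHrs/p_over.
apply: subfieldX => //; apply: Qadjoin_gen.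
by rewrite map_rcons mem_rcons mem_head.
Qed.

(** In a number field containing [s] and [a], let [E] be the subfield generated by [s]. The minimal
    polynomial of [a] over [E] is [X^2 - a^2], of which [- a] is also a root. So an automorphism
    over [E] sends [a] to [- a], and it extends to [algC]. *)
Lemma flip_aut_exists (s : seq algC) (a : algC) :
  a ^+ 2 \in Crat -> ~ Qadjoin s a ->
  exists nu : {rmorphism algC -> algC}, nu a = - a /\ (forall x, x \in s -> nu x = x).
Proof.
move=> a2 nsa.
have [L [iota [rs' rsE gen]]] := num_field_exists (rcons s a).
case/lastP: rs' rsE gen => [/(congr1 size)|rs b].
  by rewrite size_rcons.
rewrite map_rcons => /rcons_inj[rsE bE] gen.
pose E := <<1 & rs>>%AS.
have nEb : b \notin E.
  by apply/negP=> Eb; apply: nsa; rewrite -bE -rsE; apply: mem_adjoin_seq.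
have b2 : b ^+ 2 \in E.
  have [c c_eq] := CratP _ a2.
  have -> : b ^+ 2 = ratr c.
    by apply: (fmorph_inj iota); rewrite rmorphXn /= bE c_eq fmorph_rat.
  by rewrite -alg_num_field; apply: rpredZ; apply: rpred1.
pose q := 'X ^+ 2 - (b ^+ 2)%:P : {poly L}.
have q_over : q \is a polyOver E by rewrite rpredB ?rpredX ?polyOverX ?polyOverC.
have szq : size q = 3%N by rewrite size_XnsubC.
(* The minimal polynomial divides [q], and its degree is at least 2 because [b] is not in [E]. *)
have qm : minPoly E b %= q.
  rewrite -dvdp_size_eqp; last first.
    by apply: minPoly_dvdp => //; rewrite rootE !hornerE subrr.
  rewrite eqn_leq dvdp_leq ?szq; last 2 first.
  - by rewrite -size_poly_gt0 szq.
  - by apply: minPoly_dvdp => //; rewrite rootE !hornerE subrr.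
  by rewrite size_minPoly ltnS ltn_neqAle eq_sym adjoin_deg_eq1 nEb.
have rootN : root (minPoly E b) (- b) by rewrite (eqp_root qm) rootE !hornerE /= sqrrN subrr.
have idE (p : {poly L}) : map_poly \1%VF p = p.
  by apply: map_poly_id => x _; rewrite lfunE.
pose f := kHomExtend E \1%VF b (- b).
have rootN' : root (map_poly \1%VF (minPoly E b)) (- b) by rewrite idE.
have fH : kHom 1 {:L} f.
  rewrite -gen adjoin_rcons; apply: kHomExtendP => //; first exact: sub1v.
  exact: kHom1.
have fM : monoid_morphism f by apply/kHom_monoid_morphism.
pose phiM := GRing.isMonoidMorphism.Build _ _ f fM.
pose phi : {rmorphism L -> L} := HB.pack (fun_of_lfun f) phiM.
have [nu nuP] := extend_algC_subfield_aut iota phi.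
exists nu; split.
  rewrite -bE -nuP /= (kHomExtend_val (kHom1 E E)) ?rmorphN //.
move=> x; rewrite -rsE => /mapP[y y_rs ->].
rewrite -nuP /= kHomExtend_id ?lfunE //.
exact: seqv_sub_adjoin.
Qed.

(** * Ramification *)

Lemma sqrt_natK n : sqrt_nat n ^+ 2 = n%:R.
Proof. exact: sqrtCK. Qed.

Lemma sqrt_nat_ge0 n : 0 <= sqrt_nat n.
Proof. by rewrite sqrtC_ge0 ler0n. Qed.

Lemma sqrt_natM m n : sqrt_nat (m * n) = sqrt_nat m * sqrt_nat n.
Proof. by rewrite /sqrt_nat natrM rootCMl ?ler0n. Qed.

Lemma sqrt_nat_neq0 n : (0 < n)%N -> sqrt_nat n != 0.
Proof. by move=> n0; rewrite sqrtC_eq0 pnatr_eq0 -lt0n. Qed.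

(** If [x ^+ 2] is a root of a monic integral polynomial [P], then [x] is a root of [P(X^2)]. *)
Lemma Aint_sqrt x : x ^+ 2 \in Aint -> x \in Aint.
Proof.
move=> x2; pose p := minCpoly (x ^+ 2) \Po 'X^2.
apply: (@root_monic_Aint p).
- by rewrite rootE horner_comp hornerXn; apply: root_minCpoly.
- rewrite monicE lead_coef_comp ?size_polyXn // lead_coefXn expr1n mulr1.
  by rewrite -monicE minCpoly_monic.
- by apply: polyOver_comp => //; rewrite rpredX ?polyOverX.
Qed.

Lemma Aint_nat n : n%:R \in Aint.
Proof. by apply: Aint_Cnat; apply: natr_nat. Qed.

Lemma Aint_sqrt_nat n : sqrt_nat n \in Aint.
Proof. by apply: Aint_sqrt; rewrite sqrt_natK Aint_nat. Qed.

Lemma Aint_rat_nat x : x \in Crat -> x \in Aint -> 0 <= x -> exists n : nat, x = n%:R.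
Proof.
move=> xQ xA x0; have : x \in Num.nat by rewrite natrEint Cint_rat_Aint.
by case/natrP => n ->; exists n.
Qed.

Lemma sqrt_nat_rat n : sqrt_nat n \in Crat -> exists m : nat, n = (m ^ 2)%N.
Proof.
move=> /Aint_rat_nat /(_ (Aint_sqrt_nat _) (sqrt_nat_ge0 _)) [m mE].
exists m; apply/eqP; rewrite -eqC_nat natrX -mE sqrt_natK //.
Qed.

Lemma sqrt_nat_irrat p n : odd (logn p n) -> sqrt_nat n \notin Crat.
Proof. by apply: contraL => /sqrt_nat_rat[m ->]; rewrite lognX oddM. Qed.

(** Applying [adj_sqr] twice shows that otherwise the square root of one of [p], [p q], [p r],
    [p q r] is rational. Each of these integers has odd valuation at [p]. *)
Lemma sqrt_prime_notin (p q r : nat) :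
  prime p -> prime q -> prime r -> p != q -> p != r ->
  ~ Qadjoin [:: sqrt_nat q; sqrt_nat r] (sqrt_nat p).
Proof.
move=> pp pq pr npq npr H.
have Q2 n : sqrt_nat n ^+ 2 \in Crat by rewrite sqrt_natK rpred_nat.
have F1 := subfield_adj subfield_rat (Q2 q).
have Q2' n : adj (fun z => z \in Crat) (sqrt_nat q) (sqrt_nat n ^+ 2).
  by apply: adj_base => //; apply: subfield_rat.
have F2 := subfield_adj F1 (Q2' r).
have {H} H : adj (adj (fun z => z \in Crat) (sqrt_nat q)) (sqrt_nat r) (sqrt_nat p).
  apply: (Qadjoin_min F2) H => y; rewrite !inE => /orP[] /eqP->; last exact: adj_gen.
  by apply: adj_base => //; apply: adj_gen subfield_rat.
have lp n : (0 < n)%N -> ~~ (p %| n)%N -> sqrt_nat (p * n) \notin Crat.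
  move=> n0 pn; apply: (@sqrt_nat_irrat p).
  rewrite lognM ?(prime_gt0 pp) // -{2}[p]expn1 pfactorK // lognE pp n0 /=.
  by rewrite (negPf pn) addn0.
have q0 := prime_gt0 pq; have r0 := prime_gt0 pr.
have p1 : ~~ (p %| 1)%N by rewrite dvdn1; apply: contraL pp => /eqP->.
have pnq : ~~ (p %| q)%N by rewrite dvdn_prime2.
have pnr : ~~ (p %| r)%N by rewrite dvdn_prime2.
have [] := adj_sqr F1 (Q2' r) H (Q2' p).
  case/(adj_sqr subfield_rat (Q2 q)) => //.
    by rewrite -[p]muln1; apply/negP/lp.
  by rewrite -sqrt_natM; apply/negP/lp.
rewrite -sqrt_natM => /(adj_sqr subfield_rat (Q2 q)) /(_ (Q2 _)) [].
  by apply/negP/lp.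
rewrite -sqrt_natM -mulnA; apply/negP/lp; first by rewrite muln_gt0 q0 r0.
by rewrite Euclid_dvdM // negb_or pnq pnr.
Qed.

Lemma flip_sqrt_prime (p q r : nat) :
  prime p -> prime q -> prime r -> p != q -> p != r ->
  exists nu : {rmorphism algC -> algC},
    [/\ nu (sqrt_nat p) = - sqrt_nat p, nu (sqrt_nat q) = sqrt_nat q
      & nu (sqrt_nat r) = sqrt_nat r].
Proof.
move=> pp pq pr npq npr.
have [|nu [nup nus]] := @flip_aut_exists [:: sqrt_nat q; sqrt_nat r] (sqrt_nat p) _
  (sqrt_prime_notin pp pq pr npq npr).
  by rewrite sqrt_natK rpred_nat.
by exists nu; split=> //; apply: nus; rewrite !inE eqxx ?orbT.
Qed.

Section FlipNorm.
Variables (k : algC -> Prop) (s : algC) (nu : {rmorphism algC -> algC}).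
Hypotheses (kF : subfield_pred k) (ks2 : k (s ^+ 2)).
Hypotheses (nuk : forall x, k x -> nu x = x) (nus : nu s = - s).

Lemma flip_norm z : adj k s z -> k (z * nu z).
Proof.
case=> x [y [kx ky ->]].
rewrite rmorphD rmorphM /= nus !nuk //.
have -> : (x + y * s) * (x + y * - s) = x ^+ 2 - y ^+ 2 * s ^+ 2 by ring.
by apply: subfieldB => //; [|apply: subfieldM => //]; apply: subfieldX.
Qed.

Lemma flip_invol z : adj k s z -> nu (nu z) = z.
Proof.
case=> x [y [kx ky ->]].
by rewrite !(rmorphD, rmorphM, rmorphN) /= nus rmorphN /= nus opprK !nuk.
Qed.

Lemma flip_fixed z : adj k s z -> nu z = z -> k z.
Proof.
case=> x [y [kx ky ->]].
rewrite rmorphD rmorphM /= nus !nuk // => /addrI /eqP.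
rewrite mulrN eqNr => /eqP ->; by rewrite addr0.
Qed.

End FlipNorm.

(** The quantification over automorphisms makes the property visibly stable under conjugation, as
    needed when coordinates are expressed through conjugates. *)
Definition conj_div (q : nat) (b : algC) : Prop :=
  forall f : {rmorphism algC -> algC}, f b / sqrt_nat q \in Aint.

(* An ideal-free form of "q is unramified in k": up to a factor prime to [q],
   an element of [k] divisible by [sqrt q] with all its conjugates is divisible
   by [q]. *)
Definition unramified_at (q : nat) (k : algC -> Prop) : Prop :=
  forall b, k b -> conj_div q b ->
    exists2 D : nat, ~~ (q %| D)%N & D%:R * b / q%:R \in Aint.

Lemma conj_divB q a b : conj_div q a -> conj_div q b -> conj_div q (a - b).
Proof. by move=> qa qb f; rewrite rmorphB mulrBl rpredB. Qed.

Lemma conj_divM q a b : a \in Aint -> conj_div q b -> conj_div q (a * b).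
Proof. by move=> Aa qb f; rewrite rmorphM -mulrA rpredM // Aint_aut. Qed.

Lemma conj_div_aut q (nu : {rmorphism algC -> algC}) b :
  conj_div q b -> conj_div q (nu b).
Proof. by move=> qb f; apply: (qb (f \o nu : {rmorphism algC -> algC})). Qed.

(** Here [b] is an integer and [b ^+ 2 / q] is integral, so [q] divides [b ^+ 2] and hence [b]. *)
Lemma unramified_rat q : prime q -> unramified_at q (fun z => z \in Crat).
Proof.
move=> q_pr b bQ qb; exists 1%N; first by rewrite dvdn1; apply: contraL q_pr => /eqP->.
have q0 : q%:R != 0 :> algC by rewrite pnatr_eq0 -lt0n prime_gt0.
have sq0 : sqrt_nat q != 0 by rewrite sqrt_nat_neq0 ?prime_gt0.
have c := qb idfun; rewrite /= in c.
have bA : b \in Aint by rewrite -[b](divfK sq0) rpredM ?Aint_sqrt_nat.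
have c2 : b ^+ 2 / q%:R \in Num.int.
  apply: Cint_rat_Aint; first by rewrite rpred_div ?rpredX ?rpred_nat.
  by rewrite -sqrt_natK -expr_div_n rpredX.
have /intrP[n nE] := Cint_rat_Aint bQ bA; have /intrP[m mE] := c2.
have eq1 : (n ^+ 2 = m * q%:Z)%R.
  apply: (@intr_inj algC); rewrite rmorphXn rmorphM /= -nE -mE -pmulrn divfK //.
have : (q %| `|n| ^ 2)%N.
  by rewrite -abszX eq1 abszM dvdn_mull.
rewrite Euclid_dvdX // andbT => /dvdnP[t tE].
rewrite mul1r nE; apply: Aint_Cint.
have [sgn ->] : exists e : bool, n = (-1) ^+ e * (t * q)%N%:Z.
  by exists (n < 0)%R; rewrite -tE -intEsign.
rewrite rmorphM /= -(pmulrn 1 (t * q)) natrM mulrA mulfK //.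
by rewrite rpredM ?rpred_int ?rpred_nat //.
Qed.

(** Solving [b = x + y * w] and [nu b = x + y * nu w] by Cramer's rule writes [N x] and [N y] as
    integral combinations of [b] and [nu b]. Both inherit the divisibility by [sqrt q], so the
    hypothesis on [k] applies to them. The discriminant [N] is prime to [q] and is absorbed into
    [D]. *)
Lemma unramified_step q (k k' : algC -> Prop) (nu : {rmorphism algC -> algC}) w (N : nat) :
  prime q -> subfield_pred k -> unramified_at q k -> w \in Aint ->
  (forall x, k x -> nu x = x) ->
  (w - nu w) ^+ 2 = N%:R -> ~~ (q %| N)%N ->
  (forall z, k' z -> exists x y, [/\ k x, k y & z = x + y * w]) ->
  unramified_at q k'.
Proof.
move=> q_pr kF unr wA nuk wN qN k'E b /k'E[x [y [kx ky bE]]] qb.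
set d := w - nu w in wN.
have dA : d \in Aint by rewrite rpredB ?Aint_aut.
have nb : nu b = x + y * nu w by rewrite bE rmorphD rmorphM /= (nuk x) // (nuk y).
have qnb := conj_div_aut nu qb.
have yE : N%:R * y = d * (b - nu b).
  by rewrite -wN nb bE /d; ring.
have xE : N%:R * x = d * (w * nu b - nu w * b).
  by rewrite -wN nb bE /d; ring.
have kN z : k z -> k (N%:R * z) by apply: subfieldM => //; apply: subfield_nat.
have [|Dy qDy AyD] := unr _ (kN _ ky).
  by rewrite yE; apply: conj_divM => //; apply: conj_divB.
have [|Dx qDx AxD] := unr _ (kN _ kx).
  rewrite xE; apply: conj_divM => //.
  by apply: conj_divB; apply: conj_divM => //; rewrite Aint_aut.
exists (Dx * Dy * N)%N; first by rewrite !Euclid_dvdM // !negb_or qDx qDy qN.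
have -> : (Dx * Dy * N)%N%:R * b / q%:R = Dy%:R * (Dx%:R * (N%:R * x) / q%:R)
     + Dx%:R * w * (Dy%:R * (N%:R * y) / q%:R).
  by rewrite bE !natrM; ring.
by rewrite rpredD // rpredM // ?rpredM ?Aint_nat.
Qed.

Lemma unramified_adj_sqrt q k d (nu : {rmorphism algC -> algC}) :
  prime q -> subfield_pred k -> unramified_at q k ->
  (forall x, k x -> nu x = x) -> nu (sqrt_nat d) = - sqrt_nat d ->
  ~~ (q %| 4 * d)%N -> unramified_at q (adj k (sqrt_nat d)).
Proof.
move=> q_pr kF unr nuk nud qd.
apply: (@unramified_step q k _ nu (sqrt_nat d) (4 * d)) => //; first exact: Aint_sqrt_nat.
by rewrite nud opprK -mulr2n -[_ *+ 2]mulr_natl exprMn sqrt_natK -natrX -natrM.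
Qed.

Definition Aunit (x : algC) : Prop := [/\ x \in Aint, x^-1 \in Aint & x != 0].

(** As [q] divides [m], every conjugate of [b] is divisible by [sqrt q], so [D * b / q] is integral
    for some [D] prime to [q]. Squaring and removing the unit [eta] leaves the rational integer
    [D ^ 2 * m / q ^ 2]. *)
Lemma unramified_sqr q k m eta b : prime q -> unramified_at q k -> Aunit eta ->
  k b -> b ^+ 2 = m%:R * eta -> (q %| m)%N -> (q ^ 2 %| m)%N.
Proof.
move=> q_pr unr [eA eVA e0] kb bE /dvdnP[m' mE].
have q0 : q%:R != 0 :> algC by rewrite pnatr_eq0 -lt0n prime_gt0.
have [f|D qD DA] := unr _ kb.
  apply: Aint_sqrt; rewrite expr_div_n sqrt_natK -rmorphXn /= bE rmorphM rmorph_nat mE.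
  by rewrite natrM mulrAC mulfK // rpredM ?Aint_nat ?Aint_aut.
have A2 : (D ^ 2 * m)%N%:R / (q ^ 2)%N%:R \in Aint.
  have -> : (D ^ 2 * m)%N%:R / (q ^ 2)%N%:R = (D%:R * b / q%:R) ^+ 2 * eta^-1.
    by rewrite exprMn exprMn bE natrM !natrX; field; rewrite e0 q0.
  by rewrite rpredM ?rpredX.
have /Cint_rat_Aint/(_ A2)/intrP[n nE] : (D ^ 2 * m)%N%:R / (q ^ 2)%N%:R \in Crat.
  by rewrite rpred_div ?rpred_nat.
have : (q ^ 2 %| D ^ 2 * m)%N.
  apply/dvdnP; exists `|n|%N.
  have /(@intr_inj algC) : ((D ^ 2 * m)%N%:Z)%:~R = (n * (q ^ 2)%N%:Z)%:~R :> algC.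
    by rewrite intrM -!pmulrn -nE divfK // natrX expf_neq0.
  by move/(congr1 absz); rewrite abszM.
by rewrite Gauss_dvdr // coprimeXl // coprimeXr // prime_coprime.
Qed.

(* Infinite descent: each prime factor of [m] is absorbed into [b], through its
   square root when that lies in [k] and through its square otherwise. *)
Lemma unit_sqr_descent k eta (m : nat) b :
  subfield_pred k -> (forall q, prime q -> k (sqrt_nat q) \/ unramified_at q k) ->
  Aunit eta -> (0 < m)%N -> k b -> b ^+ 2 = m%:R * eta ->
  exists2 w, k w & w ^+ 2 = eta.
Proof.
move=> kF unr eU; elim/ltn_ind: m b => m IHm b m0 kb bE.
have [m1|m1] := leqP m 1.
  by exists b => //; rewrite bE (_ : m = 1%N) ?mul1r //; apply/eqP; rewrite eqn_leq m1.
have q_pr := pdiv_prime m1; have qm := pdiv_dvd m; set q := pdiv m in q_pr qm.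
have q1 := prime_gt1 q_pr; have qp := prime_gt0 q_pr.
have q0 : q%:R != 0 :> algC by rewrite pnatr_eq0 -lt0n.
case: (unr q q_pr) => [kq | uq].
  have /dvdnP[m' mE] := qm.
  have m'0 : (0 < m')%N by move: m0; rewrite mE muln_gt0 => /andP[].
  apply: (IHm m' _ (b / sqrt_nat q)) => //.
  - by rewrite mE -[X in (X < _)%N]muln1 ltn_pmul2l.
  - exact: subfield_div.
  - by rewrite expr_div_n sqrt_natK bE mE natrM mulrAC mulfK.
have /dvdnP[m' mE] := unramified_sqr q_pr uq eU kb bE qm.
have m'0 : (0 < m')%N by move: m0; rewrite mE muln_gt0 => /andP[].
apply: (IHm m' _ (b / q%:R)) => //.
- by rewrite mE -[X in (X < _)%N]muln1 ltn_pmul2l // -(exp1n 2) ltn_exp2r.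
- by apply: subfield_div => //; apply: subfield_nat.
- by rewrite expr_div_n bE mE natrM natrX mulrAC mulfK // expf_neq0.
Qed.

(** * Units *)

Lemma Aunit1 : Aunit 1.
Proof. by split; rewrite ?invr1 ?rpred1 ?oner_neq0. Qed.

Lemma Aunit_neq0 x : Aunit x -> x != 0. Proof. by case. Qed.

Lemma Aunit_Aint x : Aunit x -> x \in Aint. Proof. by case. Qed.

Lemma AunitM x y : Aunit x -> Aunit y -> Aunit (x * y).
Proof.
by move=> [xA xVA x0] [yA yVA y0]; split; rewrite ?invfM ?rpredM // mulf_neq0.
Qed.

Lemma AunitV x : Aunit x -> Aunit x^-1.
Proof. by move=> [xA xVA x0]; split; rewrite ?invrK ?invr_eq0. Qed.

Lemma AunitN1 : Aunit (- 1).
Proof. by split; rewrite ?invrN1 ?rpredN ?rpred1 ?oppr_eq0 ?oner_neq0. Qed.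

Lemma Aunit_sqrt x : Aunit (x ^+ 2) -> Aunit x.
Proof.
case=> xA xVA x0; split; [exact: Aint_sqrt | apply: Aint_sqrt | ].
  by rewrite exprVn.
by move: x0; rewrite sqrf_eq0.
Qed.

Lemma Aunit_aut (nu : {rmorphism algC -> algC}) x : Aunit x -> Aunit (nu x).
Proof. by case=> xA xVA x0; split; rewrite -?fmorphV ?Aint_aut ?fmorph_eq0. Qed.

Lemma Aunit_rat x : Aunit x -> x \in Crat -> x ^+ 2 = 1.
Proof.
move=> [xA xVA x0] xQ.
have /intrP[n nE] := Cint_rat_Aint xQ xA.
have xVQ : x^-1 \in Crat by rewrite rpredV.
have /intrP[m mE] := Cint_rat_Aint xVQ xVA.
have nm : (n * m = 1)%R.
  by apply: (@intr_inj algC); rewrite intrM -nE -mE divff.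
have : (`|n| * `|m| = 1)%N by rewrite -abszM nm.
move/eqP; rewrite muln_eq1 => /andP[/eqP n1 _].
rewrite nE (intEsign n) n1 mulr1 intr_sign; exact: sqrr_sign.
Qed.

Lemma unit_groupP k u : subfield_pred k -> unit_group k u <-> k u /\ Aunit u.
Proof.
move=> kF; split=> [[[ku uA] [v [kv vA] uv]]|[ku [uA uVA u0]]].
  have u0 : u != 0.
    by apply/eqP=> u0; move/eqP: uv; rewrite u0 mul0r eq_sym oner_eq0.
  by split=> //; split=> //; rewrite -[u^-1]mulr1 -uv mulKf.
split=> //; exists u^-1; last exact: divff.
by split=> //; apply: subfieldV.
Qed.

(** * Finitely generated multiplicative groups and their elements modulo squares *)

Lemma mul_span_min (G : algC -> Prop) s x :
  G 1 -> (forall y z, G y -> G z -> G (y / z)) -> (forall y, y \in s -> G y) ->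
  mul_span s x -> G x.
Proof.
move=> G1 Gd Gs; elim=> [y /Gs //|//|y z _ Gy _ Gz]; exact: Gd.
Qed.

Lemma mul_span_sub s s' x : (forall y, y \in s -> mul_span s' y) ->
  mul_span s x -> mul_span s' x.
Proof.
move=> ss'; apply: mul_span_min => //; first exact: mul_span_one.
by move=> y z; apply: mul_span_div.
Qed.

Lemma mul_spanV s x : mul_span s x -> mul_span s x^-1.
Proof. by move=> sx; rewrite -div1r; apply: mul_span_div => //; apply: mul_span_one. Qed.

Lemma mul_spanM s x y : mul_span s x -> mul_span s y -> mul_span s (x * y).
Proof.
by move=> sx sy; rewrite -[y]invrK; apply: mul_span_div => //; apply: mul_spanV.
Qed.

Lemma mul_spanX s x n : mul_span s x -> mul_span s (x ^+ n).
Proof.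
move=> sx; elim: n => [|n IHn]; first exact: mul_span_one.
by rewrite exprS; apply: mul_spanM.
Qed.

Lemma mul_spanXz s x (n : int) : mul_span s x -> mul_span s (x ^ n).
Proof. by move=> sx; case: n => n; [|apply: mul_spanV]; apply: mul_spanX. Qed.

(** Since [-1] is a generator, comparing squares suffices for membership; signs are discarded in
    this way throughout. *)
Lemma mul_span_sqr s x y : -1 \in s -> mul_span s x -> y ^+ 2 = x ^+ 2 -> mul_span s y.
Proof.
move=> s1 sx /eqP; rewrite eqf_sqr => /orP[] /eqP-> //.
by rewrite -mulN1r; apply: mul_spanM => //; apply: mul_span_gen.
Qed.

Lemma Aunit_span s x : (forall y, y \in s -> Aunit y) -> mul_span s x -> Aunit x.
Proof.
apply: mul_span_min; first exact: Aunit1.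
by move=> y z yU zU; apply: AunitM => //; apply: AunitV.
Qed.

Lemma subfield_span k s x : subfield_pred k -> (forall y, y \in s -> k y) ->
  mul_span s x -> k x.
Proof.
by move=> kF ks; apply: mul_span_min => //; [apply: subfield1 | apply: subfield_div].
Qed.

Lemma mul_span_nil x : mul_span [::] x -> x = 1.
Proof. by apply: (@mul_span_min (fun y => y = 1)) => // y z -> ->; rewrite divff ?oner_neq0. Qed.

Lemma mul_span_cons a s x : a != 0 -> mul_span (a :: s) x ->
  exists (n : int) y, mul_span s y /\ x = a ^ n * y.
Proof.
move=> a0; pose G x := exists (n : int) y, mul_span s y /\ x = a ^ n * y.
apply: (@mul_span_min G) => [|y z [n [y' [sy ->]]] [m [z' [sz ->]]]|y].
- by exists 0, 1; rewrite expr0z mulr1; split=> //; apply: mul_span_one.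
- exists (n - m), (y' / z'); split; first exact: mul_span_div.
  by rewrite expfzDr // -invr_expz invfM mulrACA.
rewrite inE => /orP[/eqP->|sy].
  by exists 1, 1; rewrite expr1z mulr1; split=> //; apply: mul_span_one.
by exists 0, y; rewrite expr0z mul1r; split=> //; apply: mul_span_gen.
Qed.

Lemma exprz_parity (a : algC) (n : int) : a != 0 ->
  exists (m : int) (b : bool), a ^ n = (a ^ m) ^+ 2 * a ^+ b.
Proof.
move=> a0; exists (n %/ 2)%Z, ((n %% 2)%Z != 0).
rewrite {1}(divz_eq n 2) expfzDr // -exprz_exp; congr (_ * _).
have := modz_ge0 n (isT : 2 != 0 :> int); have := ltz_pmod n (isT : 0 < 2 :> int).
by case: (n %% 2)%Z => [[|[|]]|].
Qed.

(** Each exponent is reduced modulo 2, leaving finitely many classes modulo squares, among which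
    signs and norms can decide. *)
Lemma mul_span_mod_sqr s x : (forall y, y \in s -> y != 0) -> mul_span s x ->
  exists t (bs : seq bool),
    [/\ size bs = size s, mul_span s t
      & x = t ^+ 2 * \prod_(p <- zip s bs) p.1 ^+ p.2].
Proof.
elim: s x => [|a s IHs] x s0.
  move/mul_span_nil->; exists 1, [::]; split=> //; first exact: mul_span_one.
  by rewrite big_nil mulr1 expr1n.
have a0 : a != 0 by apply: s0; rewrite mem_head.
case/(mul_span_cons a0) => n [y [sy ->]].
have [|t [bs [szbs st ->]]] := IHs y _ sy.
  by move=> z sz; apply: s0; rewrite inE sz orbT.
have [m [b ->]] := exprz_parity n a0.
exists (a ^ m * t), (b :: bs); split; first by rewrite /= szbs.
- apply: mul_spanM; first by apply/mul_spanXz/mul_span_gen/mem_head.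
  by apply: mul_span_sub st => z sz; apply: mul_span_gen; rewrite inE sz orbT.
- by rewrite /= big_cons /=; ring.
Qed.

(** * Galois action on generated fields, and signs of real elements *)

Lemma aut_fix_Qadjoin (nu : {rmorphism algC -> algC}) gs x :
  (forall g, g \in gs -> nu g = g) -> Qadjoin gs x -> nu x = x.
Proof.
apply: Qadjoin_min; split=> [|y z|y z]; first exact: rmorph1.
  by rewrite rmorphB => -> ->.
by rewrite fmorph_div => -> ->.
Qed.

Lemma Qadjoin_stable (nu : {rmorphism algC -> algC}) gs x :
  (forall g, g \in gs -> Qadjoin gs (nu g)) -> Qadjoin gs x -> Qadjoin gs (nu x).
Proof.
move=> st; have F := subfield_Qadjoin gs.
apply: (@Qadjoin_min (fun x => Qadjoin gs (nu x))) => //; split=> [|y z|y z].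
- rewrite rmorph1; exact: subfield1.
- by rewrite rmorphB; apply: subfieldB.
- by rewrite fmorph_div; apply: subfield_div.
Qed.

Lemma Qsqrt_adj d z : Qsqrt d z <-> adj (fun z => z \in Crat) (sqrt_nat d) z.
Proof.
have Q2 : sqrt_nat d ^+ 2 \in Crat by rewrite sqrt_natK rpred_nat.
have F := subfield_Qadjoin [:: sqrt_nat d].
split.
  apply: Qadjoin_min; first by apply: subfield_adj subfield_rat Q2.
  by move=> y; rewrite inE => /eqP->; apply: adj_gen subfield_rat.
apply: adj_sub => //; first exact: subfield_Crat.
by apply: Qadjoin_gen; rewrite mem_head.
Qed.

Lemma Qsqrt_fix (nu : {rmorphism algC -> algC}) d x :
  nu (sqrt_nat d) = sqrt_nat d -> Qsqrt d x -> nu x = x.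
Proof. by move=> nud; apply: aut_fix_Qadjoin => g; rewrite inE => /eqP->. Qed.

Lemma real_Qadjoin gs x : (forall g, g \in gs -> g \is Num.real) ->
  Qadjoin gs x -> x \is Num.real.
Proof. exact: Qadjoin_min subfield_real. Qed.

Lemma sqrt_nat_real n : sqrt_nat n \is Num.real.
Proof. by rewrite ger0_real ?sqrt_nat_ge0. Qed.

Lemma real_sqr_gt0 (x : algC) : x \is Num.real -> x != 0 -> 0 < x ^+ 2.
Proof. by move=> xR x0; rewrite lt_def sqrf_eq0 x0 real_exprn_even_ge0. Qed.

Lemma sqr_pos_inj (x y : algC) : 0 < x -> 0 < y -> x ^+ 2 = y ^+ 2 -> x = y.
Proof. by move=> x0 y0 /eqP; rewrite eqrXn2 // ?ltW // => /eqP. Qed.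

Lemma sign_gt0 (c : bool) (t : algC) : 0 < t -> 0 < (-1) ^+ c * t -> c = false.
Proof.
case: c => // t0; rewrite mulN1r oppr_gt0 => t0'.
by have := lt_trans t0 t0'; rewrite ltxx.
Qed.

Lemma exprz_gt1_eq0 (e : algC) (n : int) : 1 < e -> e ^ n = 1 -> n = 0.
Proof.
move=> e1; have gt1 m : 1 < e ^+ m.+1 by rewrite exprn_egt1.
case: n => [[|m]|m] //; first by move=> E; have := gt1 m; rewrite exprnP E ltxx.
by move=> /(congr1 GRing.inv); rewrite invrK invr1 => E; have := gt1 m; rewrite E ltxx.
Qed.

(** * Fundamental units and their conjugates *)

Section FundamentalUnit.
Variables (d : nat) (e : algC) (fe : fundamental_unit d e).

Lemma fund_gt1 : 1 < e. Proof. by case: fe. Qed.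
Lemma fund_gt0 : 0 < e. Proof. exact: lt_trans ltr01 fund_gt1. Qed.

Lemma fund_unit : Qsqrt d e /\ Aunit e.
Proof.
apply/unit_groupP; first exact: subfield_Qadjoin.
by case: fe => _ ->; apply: mul_span_gen; rewrite !inE eqxx orbT.
Qed.

Lemma fund_Q : Qsqrt d e. Proof. by case: fund_unit. Qed.
Lemma fund_Aunit : Aunit e. Proof. by case: fund_unit. Qed.

Lemma fund_power x : Qsqrt d x -> Aunit x -> exists n : int, x ^+ 2 = (e ^ n) ^+ 2.
Proof.
move=> xQ xU.
have /(proj2 fe) : unit_group (Qsqrt d) x.
  by apply/unit_groupP => //; apply: subfield_Qadjoin.
case/mul_span_cons; first by rewrite oppr_eq0 oner_neq0.
move=> m [y [/(mul_span_cons (Aunit_neq0 fund_Aunit)) [n [z [/mul_span_nil-> ->]]] ->]].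
exists n; rewrite mulr1 exprMn; suff -> : ((-1) ^ m) ^+ 2 = 1 :> algC by rewrite mul1r.
by rewrite exprnP exprzAC -exprnP sqrrN expr1n exp1rz.
Qed.

(** A root [w] would be [e ^ n] up to sign, giving [e ^ (1 - 2 n) = 1]. This is impossible because
    [e > 1] and the exponent is odd. *)
Lemma fund_nonsquare w : Qsqrt d w -> w ^+ 2 <> e.
Proof.
move=> wQ w2; have wU : Aunit w by apply: Aunit_sqrt; rewrite w2; apply: fund_Aunit.
have [n] := fund_power wQ wU; rewrite w2 exprnP exprz_exp.
move=> en; have e0 := Aunit_neq0 fund_Aunit.
have /(exprz_gt1_eq0 fund_gt1) /eqP : e ^ (1 - n * 2) = 1.
  by rewrite expfzDr // -invr_expz -en expr1z divff.
rewrite subr_eq0 => /eqP /(congr1 (fun m => odd `|m|)).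
by rewrite abszM oddM andbF.
Qed.

(* [e] has norm -1 (resp. 1), expressed through the automorphisms of [algC]
   that flip [sqrt d]. *)
Definition neg_conj : Prop :=
  forall nu : {rmorphism algC -> algC}, nu (sqrt_nat d) = - sqrt_nat d -> nu e = - e^-1.
Definition pos_conj : Prop :=
  forall nu : {rmorphism algC -> algC}, nu (sqrt_nat d) = - sqrt_nat d -> nu e = e^-1.

Lemma quad_norm_conj n (nu : {rmorphism algC -> algC}) : quad_norm d e n ->
  nu (sqrt_nat d) = - sqrt_nat d -> nu e = ratr n * e^-1.
Proof.
move=> [x [y [eE ->]]] nud.
have e0 := Aunit_neq0 fund_Aunit.
have -> : nu e = ratr x - ratr y * sqrt_nat d.
  by rewrite eE rmorphD fmorph_rat [nu (_ * _)]rmorphM fmorph_rat nud mulrN.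
apply: (mulIf e0); rewrite divfK // eE.
have -> : ratr (x ^+ 2 - d%:R * y ^+ 2) = ratr x ^+ 2 - sqrt_nat d ^+ 2 * ratr y ^+ 2 :> algC.
  by rewrite !CratrE sqrt_natK.
ring.
Qed.

Lemma quad_norm_neg : quad_norm d e (-1) -> neg_conj.
Proof. by move=> qn nu nud; rewrite (quad_norm_conj qn nud) rmorphN rmorph1 mulN1r. Qed.

Lemma quad_norm_pos : quad_norm d e 1 -> pos_conj.
Proof. by move=> qn nu nud; rewrite (quad_norm_conj qn nud) rmorph1 mul1r. Qed.

(** The norm [e * nu e] is a rational unit, hence 1 or -1. *)
Lemma conj_dichotomy (nu : {rmorphism algC -> algC}) :
  nu (sqrt_nat d) = - sqrt_nat d -> neg_conj \/ nu e = e^-1.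
Proof.
move=> nud; have e0 := Aunit_neq0 fund_Aunit.
have eQ := (Qsqrt_adj _ _).1 fund_Q.
have s2 : sqrt_nat d ^+ 2 \in Crat by rewrite sqrt_natK rpred_nat.
have nQ := flip_norm subfield_rat s2 (aut_Crat nu) nud eQ.
have /eqP : (e * nu e) ^+ 2 = 1.
  by apply: Aunit_rat => //; apply: AunitM; [|apply: Aunit_aut]; apply: fund_Aunit.
rewrite sqrf_eq1 => /orP[] /eqP en.
  by right; apply: (mulfI e0); rewrite en divff.
left=> nu' nu'd.
(* All automorphisms that flip [sqrt d] agree on the quadratic field, so one of them decides for
   all. *)
have -> : nu' e = nu e.
  case: eQ => x [y [xQ yQ ->]].
  by rewrite !rmorphD !rmorphM /= nud nu'd !aut_Crat.
by apply: (mulfI e0); rewrite en mulrN divff.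
Qed.

End FundamentalUnit.

(** The unit [1 + sqrt 2] has norm -1 and is a power of [e] up to sign, so [e] cannot have norm
    1. *)
Lemma fund2_neg (e : algC) (nu : {rmorphism algC -> algC}) :
  nu (sqrt_nat 2) = - sqrt_nat 2 -> fundamental_unit 2 e -> neg_conj 2 e.
Proof.
move=> nud fe; case: (conj_dichotomy fe nud) => // nue.
have F := subfield_Qadjoin [:: sqrt_nat 2].
have nrm : (1 + sqrt_nat 2) * (sqrt_nat 2 - 1) = 1.
  by transitivity (sqrt_nat 2 ^+ 2 - 1); [ring | rewrite sqrt_natK; ring].
have n0 : 1 + sqrt_nat 2 != 0.
  by apply/eqP=> z; move/eqP: nrm; rewrite z mul0r eq_sym oner_eq0.
have invE : (1 + sqrt_nat 2)^-1 = sqrt_nat 2 - 1 by apply: (mulfI n0); rewrite divff.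
have uQ : Qsqrt 2 (1 + sqrt_nat 2).
  by apply: subfieldD => //; [apply: subfield1 | apply: Qadjoin_gen; rewrite mem_head].
have uU : Aunit (1 + sqrt_nat 2).
  by split=> //; rewrite ?invE; [rewrite rpredD | rewrite rpredB]; rewrite ?Aint_sqrt_nat ?rpred1.
have [m /eqP] := fund_power fe uQ uU; rewrite eqf_sqr => uE.
have e0 := Aunit_neq0 (fund_Aunit fe).
have nm : e ^ m * nu (e ^ m) = 1.
  by rewrite rmorphXz ?unitfE // nue exprz_inv -invr_expz divff // expfz_neq0.
have : (1 + sqrt_nat 2) * nu (1 + sqrt_nat 2) = 1.
  by case/orP: uE => /eqP->; rewrite ?rmorphN ?mulrNN.
have -> : (1 + sqrt_nat 2) * nu (1 + sqrt_nat 2) = - ((1 + sqrt_nat 2) * (sqrt_nat 2 - 1)).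
  by rewrite rmorphD rmorph1 nud; ring.
by rewrite nrm => /eqP; rewrite eqNr oner_eq0.
Qed.

(** * Biquadratic fields *)

(** The condition under which the descent removes every prime from [m]: each ramified prime is
    already a square in [k]. *)
Definition tame (k : algC -> Prop) : Prop :=
  forall q, prime q -> k (sqrt_nat q) \/ unramified_at q k.

(** The quotient [b ^+ 2 / eta] is rational, integral and positive, hence a positive integer [m],
    and the descent applies to [b ^+ 2 = m * eta]. *)
Lemma unit_sqr_rat k eta b : subfield_pred k -> tame k -> Aunit eta -> 0 < eta ->
  k b -> b \in Aint -> b \is Num.real -> b != 0 -> b ^+ 2 / eta \in Crat ->
  exists2 w, k w & w ^+ 2 = eta.
Proof.
move=> kF kT eU e0 kb bA bR b0 mQ.
have b2 : 0 < b ^+ 2 / eta by rewrite divr_gt0 // real_sqr_gt0.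
have mA : b ^+ 2 / eta \in Aint by rewrite rpredM ?rpredX //; case: eU.
have [m mE] := Aint_rat_nat mQ mA (ltW b2).
apply: (@unit_sqr_descent k eta m b) => //; first by rewrite mE ltr0n in b2.
by rewrite -mE divfK // gt_eqF.
Qed.

Lemma pos_conj_sqrt k d e (nu : {rmorphism algC -> algC}) :
  subfield_pred k -> tame k -> fundamental_unit d e -> k e ->
  nu (sqrt_nat d) = - sqrt_nat d -> nu e = e^-1 -> exists2 w, k w & w ^+ 2 = e.
Proof.
move=> kF kT fe ke nud nue.
have e0 := fund_gt0 fe; have eU := fund_Aunit fe; have en0 := Aunit_neq0 eU.
have e10 : 0 < e + 1 by rewrite addr_gt0.
(* The quotient [(e + 1) ^+ 2 / e] equals [e + 2 + e^-1], which conjugation fixes when [e] has norm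
   1. *)
apply: (@unit_sqr_rat k e (e + 1)) => //.
- by apply: subfieldD => //; apply: subfield1.
- by rewrite rpredD ?rpred1 //; apply: Aunit_Aint.
- exact: gtr0_real.
- by rewrite gt_eqF.
apply: (flip_fixed (k := fun z => z \in Crat) (aut_Crat nu) nud).
  apply/Qsqrt_adj; have F := subfield_Qadjoin [:: sqrt_nat d].
  apply: subfield_div => //; last exact: fund_Q fe.
  by apply: subfieldX => //; apply: subfieldD => //; [apply: fund_Q fe | apply: subfield1].
rewrite fmorph_div rmorphXn rmorphD rmorph1 nue; field.
by rewrite en0.
Qed.

(** If [e] had norm 1 it would be a square in [Q(sqrt p)], where [p] is the only ramified prime; a
    fundamental unit is not a square. *)
Lemma fund_prime_neg p e (nu : {rmorphism algC -> algC}) :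
  prime p -> p = 1 %[mod 4] -> nu (sqrt_nat p) = - sqrt_nat p ->
  fundamental_unit p e -> neg_conj p e.
Proof.
move=> p_pr p4 nup fe; case: (conj_dichotomy fe nup) => // nue.
have F := subfield_Qadjoin [:: sqrt_nat p].
have pQ : Qsqrt p (sqrt_nat p) by apply: Qadjoin_gen; rewrite mem_head.
suff kT : tame (Qsqrt p).
  have [w wQ w2] := pos_conj_sqrt F kT fe (fund_Q fe) nup nue.
  by case: (fund_nonsquare fe wQ w2).
move=> q q_pr; have [->|nqp] := eqVneq q p; [by left | right].
(* Its conjugates differ by [sqrt p], so the discriminant is [p] and the prime 2 is covered too. It
   is a root of [X^2 - X - (p - 1) / 4], with [p %/ 4] for the last coefficient. *)
pose w := (1 + sqrt_nat p) / 2%:R.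
have wE : sqrt_nat p = 2%:R * w - 1 by rewrite /w; field.
have pE : p = (4 * (p %/ 4) + 1)%N by rewrite {1}(divn_eq p 4) mulnC p4.
have wA : w \in Aint.
  apply: (@root_monic_Aint ('X^2 - 'X - (p %/ 4)%:R%:P)).
  - rewrite rootE !hornerE.
    have : sqrt_nat p ^+ 2 = 4%:R * (p %/ 4)%:R + 1 by rewrite sqrt_natK {1}pE natrD natrM.
    rewrite wE => H; have -> : w ^+ 2 - w - (p %/ 4)%:R =
      ((2%:R * w - 1) ^+ 2 - (4%:R * (p %/ 4)%:R + 1)) / 4%:R by field.
    by rewrite H subrr mul0r.
  - rewrite -addrA -opprD monicE lead_coefDl ?lead_coefXn //.
    by rewrite size_polyXn size_polyN size_XaddC.
  - apply/polyOverP=> i; rewrite coefB coefB coefXn coefX coefC.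
    by case: (i == 0)%N; rewrite ?subr0 ?rpredB ?rpred_nat.
apply: (@unramified_step q (fun z => z \in Crat) _ nu w p) => //.
- exact: subfield_rat.
- exact: unramified_rat.
- exact: aut_Crat.
- by rewrite -sqrt_natK /w fmorph_div rmorphD rmorph1 rmorph_nat nup; field.
- by rewrite dvdn_prime2.
move=> z /Qsqrt_adj[x [y [xQ yQ ->]]].
exists (x - y), (2%:R * y); split.
- exact: rpredB.
- by rewrite rpredM ?rpred_nat.
- rewrite wE; ring.
Qed.

(** * Units of [Q(sqrt d1, sqrt d2)] when [e1] and [e2] have norm -1 *)

Section Line.
Variables (d1 d2 : nat) (e1 e2 e3 : algC) (sg ta : {rmorphism algC -> algC}).
Hypothesis d1_gt0 : (0 < d1)%N.
Hypotheses (fe1 : fundamental_unit d1 e1) (fe2 : fundamental_unit d2 e2)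
           (fe3 : fundamental_unit (d1 * d2) e3).
Hypotheses (sg1 : sg (sqrt_nat d1) = sqrt_nat d1) (sg2 : sg (sqrt_nat d2) = - sqrt_nat d2).
Hypotheses (ta1 : ta (sqrt_nat d1) = - sqrt_nat d1) (ta2 : ta (sqrt_nat d2) = sqrt_nat d2).
Hypotheses (ne1 : neg_conj d1 e1) (ne2 : neg_conj d2 e2).

Let k := Qadjoin [:: sqrt_nat d1; sqrt_nat d2].
Let kF : subfield_pred k := subfield_Qadjoin _.

Let k1 : k (sqrt_nat d1). Proof. by apply: Qadjoin_gen; rewrite !inE eqxx. Qed.
Let k2 : k (sqrt_nat d2). Proof. by apply: Qadjoin_gen; rewrite !inE eqxx orbT. Qed.

Let sub_k d x : k (sqrt_nat d) -> Qsqrt d x -> k x.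
Proof. by move=> kd; apply: Qadjoin_min => // y; rewrite inE => /eqP->. Qed.

Let ke1 : k e1. Proof. exact: sub_k (fund_Q fe1). Qed.
Let ke2 : k e2. Proof. exact: sub_k (fund_Q fe2). Qed.
Let ke3 : k e3.
Proof. by apply: sub_k (fund_Q fe3); rewrite sqrt_natM; apply: subfieldM. Qed.

Let sqrt_in d n : Qsqrt d (sqrt_nat n ^+ 2).
Proof. by rewrite sqrt_natK; apply: subfield_nat; apply: subfield_Qadjoin. Qed.

Let adjF d n : subfield_pred (adj (Qsqrt d) (sqrt_nat n)).
Proof. by apply: subfield_adj; [apply: subfield_Qadjoin | apply: sqrt_in]. Qed.

Let Qd d : Qsqrt d (sqrt_nat d). Proof. by apply: Qadjoin_gen; rewrite mem_head. Qed.

Let QF d : subfield_pred (Qsqrt d). Proof. exact: subfield_Qadjoin. Qed.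

Let k_adj1 x : k x -> adj (Qsqrt d1) (sqrt_nat d2) x.
Proof.
apply: Qadjoin_min => // y; rewrite !inE => /orP[] /eqP->; last exact: adj_gen.
exact: adj_base.
Qed.

Let k_adj2 x : k x -> adj (Qsqrt d2) (sqrt_nat d1) x.
Proof.
apply: Qadjoin_min => // y; rewrite !inE => /orP[] /eqP->; first exact: adj_gen.
exact: adj_base.
Qed.

Let k_adj3 x : k x -> adj (Qsqrt (d1 * d2)) (sqrt_nat d1) x.
Proof.
apply: Qadjoin_min => // y; rewrite !inE => /orP[] /eqP->; first exact: adj_gen.
have -> : sqrt_nat d2 = sqrt_nat (d1 * d2) / sqrt_nat d1.
  by rewrite sqrt_natM mulrC mulKf // sqrt_nat_neq0.
by apply: subfield_div => //; [apply: adj_base | apply: adj_gen].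
Qed.

Let sg3 : sg (sqrt_nat (d1 * d2)) = - sqrt_nat (d1 * d2).
Proof. by rewrite sqrt_natM rmorphM /= sg1 sg2 mulrN. Qed.
Let ta3 : ta (sqrt_nat (d1 * d2)) = - sqrt_nat (d1 * d2).
Proof. by rewrite sqrt_natM rmorphM /= ta1 ta2 mulNr. Qed.

Let sge1 : sg e1 = e1. Proof. exact: Qsqrt_fix (fund_Q fe1). Qed.
Let tae2 : ta e2 = e2. Proof. exact: Qsqrt_fix (fund_Q fe2). Qed.

Let e1_gt0 := fund_gt0 fe1.
Let e2_gt0 := fund_gt0 fe2.
Let e3_gt0 := fund_gt0 fe3.
Let e1_neq0 := Aunit_neq0 (fund_Aunit fe1).
Let e2_neq0 := Aunit_neq0 (fund_Aunit fe2).
Let e3_neq0 := Aunit_neq0 (fund_Aunit fe3).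

(* With [w = sqrt (e1 e2 e3)], the witness [e1 e2 e3 + e1 + e2 - e3] is [w] times
   the sum of the conjugates of [w], with the signs making that sum stable
   (up to sign) under the Galois group. *)
Lemma neg_line_sqrt (K : algC -> Prop) : subfield_pred K -> tame K ->
  K (sqrt_nat d1) -> K (sqrt_nat d2) -> neg_conj (d1 * d2) e3 ->
  exists2 w, K w & w ^+ 2 = e1 * e2 * e3.
Proof.
move=> KF KT Kd1 Kd2 ne3.
have kK x : k x -> K x.
  by apply: Qadjoin_min => // y; rewrite !inE => /orP[] /eqP->.
set b := e1 * e2 * e3 + e1 + e2 - e3.
have eU : Aunit (e1 * e2 * e3).
  by do 2?[apply: AunitM]; [apply: fund_Aunit fe1 | apply: fund_Aunit fe2 | apply: fund_Aunit fe3].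
have kb : k b.
  apply: subfieldB => //; do 2?[apply: subfieldD => //].
  by do 2?[apply: subfieldM => //].
have b_gt0 : 0 < b.
  (* In this form [b] is visibly positive, as [e1] and [e2] exceed 1. *)
  have -> : b = (e1 * e2 - 1) * e3 + e1 + e2 by rewrite /b; ring.
  by rewrite !addr_gt0 // mulr_gt0 // subr_gt0 mulr_egt1 ?(fund_gt1 fe1) ?(fund_gt1 fe2).
apply: (unit_sqr_rat KF KT eU) (kK _ kb) _ _ _ _.
- by rewrite !mulr_gt0.
- rewrite rpredB ?rpredD //; try exact: Aunit_Aint (fund_Aunit fe1);
  try exact: Aunit_Aint (fund_Aunit fe2); try exact: Aunit_Aint (fund_Aunit fe3).
  exact: Aunit_Aint.
- exact: gtr0_real.
- by rewrite gt_eqF.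
have kq : k (b ^+ 2 / (e1 * e2 * e3)).
  apply: subfield_div => //; first exact: subfieldX.
  by do 2?[apply: subfieldM => //].
(* Invariance under [sg] places the quotient in [Q(sqrt d1)]; invariance under [ta] then makes it
   rational. *)
apply: (flip_fixed (k := fun z => z \in Crat) (aut_Crat ta) ta1).
  apply/Qsqrt_adj; apply: (flip_fixed (k := Qsqrt d1) _ sg2 (k_adj1 kq)).
    by move=> x; apply: Qsqrt_fix.
  rewrite /b fmorph_div !(rmorphXn, rmorphB, rmorphD, rmorphM) /= sge1 (ne2 sg2) (ne3 sg sg3).
  by field; rewrite e1_neq0 e2_neq0 e3_neq0.
rewrite /b fmorph_div !(rmorphXn, rmorphB, rmorphD, rmorphM) /= tae2 (ne1 ta1) (ne3 ta ta3).
by field; rewrite e1_neq0 e2_neq0 e3_neq0.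
Qed.

Let k_real x : k x -> x \is Num.real.
Proof.
by apply: real_Qadjoin => g; rewrite !inE => /orP[] /eqP->; apply: sqrt_nat_real.
Qed.

Let k_sg x : k x -> k (sg x).
Proof.
apply: Qadjoin_stable => g; rewrite !inE => /orP[] /eqP->; rewrite ?sg1 ?sg2 //.
exact: subfieldN.
Qed.

Let k_ta x : k x -> k (ta x).
Proof.
apply: Qadjoin_stable => g; rewrite !inE => /orP[] /eqP->; rewrite ?ta1 ?ta2 //.
exact: subfieldN.
Qed.

(** The product of the relative norms of [v] to the three quadratic subfields is [v ^+ 2] times its
    absolute norm, which is 1 or -1. Each relative norm is a power of a fundamental unit up to sign.
    Comparing squares and using positivity removes all signs. *)
Lemma line_unit_sqr v : k v -> Aunit v ->
  exists a1 a2 a3 : int, v ^+ 2 = e1 ^ a1 * e2 ^ a2 * e3 ^ a3.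
Proof.
move=> kv vU.
have U (nu : {rmorphism algC -> algC}) : Aunit (v * nu v) by apply: AunitM => //; apply: Aunit_aut.
have F1 : Qsqrt d1 (v * sg v).
  apply: flip_norm (k_adj1 kv) => // x; exact: Qsqrt_fix.
have F2 : Qsqrt d2 (v * ta v).
  apply: flip_norm (k_adj2 kv) => // x; exact: Qsqrt_fix.
have F3 : Qsqrt (d1 * d2) (v * (ta \o sg) v).
  apply: (flip_norm (QF _) (sqrt_in _ _) _ _ (k_adj3 kv)) => /= [x|]; last by rewrite sg1 ta1.
  apply: (@Qsqrt_fix (ta \o sg : {rmorphism algC -> algC})) => /=.
  by rewrite sg3 rmorphN /= ta3 opprK.
have [a1 E1] := fund_power fe1 F1 (U sg).
have [a2 E2] := fund_power fe2 F2 (U ta).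
have [a3 E3] := fund_power fe3 F3 (U (ta \o sg : {rmorphism algC -> algC})).
exists a1, a2, a3.
have v0 := Aunit_neq0 vU.
have NQ : v * sg v * ta (v * sg v) \in Crat.
  apply: (flip_norm subfield_rat _ (aut_Crat ta) ta1 ((Qsqrt_adj _ _).1 F1)).
  by rewrite sqrt_natK rpred_nat.
have N1 : (v * sg v * ta (v * sg v)) ^+ 2 = 1.
  by apply: Aunit_rat => //; apply: AunitM; [apply: U | apply/Aunit_aut/U].
apply: sqr_pos_inj.
- by apply: real_sqr_gt0 => //; apply: k_real.
- by rewrite !mulr_gt0 // exprz_gt0.
rewrite !exprMn -E1 -E2 -E3 -[LHS]mulr1 -N1 rmorphM /=; ring.
Qed.

(** Modulo squares, [v ^+ 2] becomes [r ^+ 2] with exponents [c1], [c2], [c3] equal to 0 or 1. As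
    [r] has real conjugates, [sg (r ^+ 2)] and [ta (r ^+ 2)] are positive. This forces
    [c1 = c2 = c3] if [e3] has norm -1, and [c1 = c2 = 0] if it has norm 1; either way [r] is a
    power of [W] up to sign. *)
Lemma line_unit v W : k v -> Aunit v ->
  (neg_conj (d1 * d2) e3 /\ W ^+ 2 = e1 * e2 * e3) \/
  (pos_conj (d1 * d2) e3 /\ W ^+ 2 = e3) ->
  mul_span [:: -1; e1; e2; W] v.
Proof.
move=> kv vU We.
have [a1 [a2 [a3 vE]]] := line_unit_sqr kv vU.
have [b1 [c1 E1]] := exprz_parity a1 e1_neq0.
have [b2 [c2 E2]] := exprz_parity a2 e2_neq0.
have [b3 [c3 E3]] := exprz_parity a3 e3_neq0.
set t := e1 ^ b1 * e2 ^ b2 * e3 ^ b3.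
have t0 : t != 0 by rewrite !mulf_neq0 ?expfz_neq0.
set S := [:: -1; e1; e2; W].
have S1 : mul_span S e1 by apply: mul_span_gen; rewrite !inE eqxx orbT.
have S2 : mul_span S e2 by apply: mul_span_gen; rewrite !inE eqxx !orbT.
have SW : mul_span S W by apply: mul_span_gen; rewrite !inE eqxx !orbT.
have SN : -1 \in S by rewrite mem_head.
have S3 : mul_span S e3.
  case: We => [[_ WE]|[_ <-]]; last exact: mul_spanX.
  have -> : e3 = W ^+ 2 / (e1 * e2) by rewrite WE mulrC mulKf // mulf_neq0.
  by apply: mul_span_div; [apply: mul_spanX | apply: mul_spanM].
have St : mul_span S t by do 2?[apply: mul_spanM]; apply: mul_spanXz.
have kXz x (n : int) : k x -> k (x ^ n).
  by move=> kx; case: n => n; [|apply: subfieldV => //]; apply: subfieldX.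
have kt : k t by do 2?[apply: subfieldM => //]; apply: kXz.
set r := v / t.
have kr : k r by apply: subfield_div.
have vr : v = t * r by rewrite mulrC divfK.
have r0 : r != 0 by rewrite mulf_neq0 ?invr_eq0 // Aunit_neq0.
have r2 : r ^+ 2 = e1 ^+ c1 * e2 ^+ c2 * e3 ^+ c3.
  apply: (mulfI (expf_neq0 2 t0)); rewrite -exprMn -vr vE E1 E2 E3 /t; ring.
rewrite vr; apply: mul_spanM => //.
have pos x : k x -> x != 0 -> 0 < x ^+ 2 by move=> kx; apply/real_sqr_gt0/k_real.
have := pos _ (k_sg kr); have := pos _ (k_ta kr).
rewrite !fmorph_eq0 r0 -!rmorphXn r2 => /(_ isT) + /(_ isT).
rewrite !rmorphM !rmorphXn /= sge1 tae2 (ne1 ta1) (ne2 sg2).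
have Vp n (e : algC) : 0 < e -> 0 < e^-1 ^+ n by move=> e0; rewrite exprn_gt0 // invr_gt0.
case: We => [[ne3 WE]|[pe3 WE]].
  rewrite (ne3 sg sg3) (ne3 ta ta3) [(- e1^-1) ^+ _]exprNn [(- e2^-1) ^+ _]exprNn.
  rewrite ![(- e3^-1) ^+ _]exprNn => ps qs.
  have c13 : c1 (+) c3 = false.
    apply: (@sign_gt0 _ (e1^-1 ^+ c1 * e2 ^+ c2 * e3^-1 ^+ c3)).
      by rewrite !mulr_gt0 ?Vp ?exprn_gt0.
    by move: ps; congr (0 < _); rewrite signr_addb; ring.
  have c23 : c2 (+) c3 = false.
    apply: (@sign_gt0 _ (e1 ^+ c1 * e2^-1 ^+ c2 * e3^-1 ^+ c3)).
      by rewrite !mulr_gt0 ?Vp ?exprn_gt0.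
    by move: qs; congr (0 < _); rewrite signr_addb; ring.
  have c1E : c1 = c3 by apply/eqP; rewrite -negb_add c13.
  have c2E : c2 = c3 by apply/eqP; rewrite -negb_add c23.
  apply: (@mul_span_sqr _ (W ^+ c3)) => //; first exact: mul_spanX.
  by rewrite r2 c1E c2E exprAC WE !exprMn.
rewrite (pe3 sg sg3) (pe3 ta ta3) [(- e1^-1) ^+ _]exprNn [(- e2^-1) ^+ _]exprNn => ps qs.
have c1E : c1 = false.
  apply: (@sign_gt0 _ (e1^-1 ^+ c1 * e2 ^+ c2 * e3^-1 ^+ c3)).
    by rewrite !mulr_gt0 ?Vp ?exprn_gt0.
  by rewrite !mulrA.
have c2E : c2 = false.
  apply: (@sign_gt0 _ (e1 ^+ c1 * e2^-1 ^+ c2 * e3^-1 ^+ c3)).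
    by rewrite !mulr_gt0 ?Vp ?exprn_gt0.
  by move: qs; congr (0 < _); ring.
apply: (@mul_span_sqr _ (W ^+ c3)) => //; first exact: mul_spanX.
by rewrite r2 c1E c2E exprAC WE !expr0 !mul1r.
Qed.

End Line.

(** * The triquadratic field *)

Lemma subfield_sqr_root k x w : subfield_pred k -> k w -> x ^+ 2 = w ^+ 2 -> k x.
Proof.
by move=> kF kw /eqP; rewrite eqf_sqr => /orP[] /eqP-> //; apply: subfieldN.
Qed.

Lemma unramified_sub q k k' : (forall x, k x -> k' x) ->
  unramified_at q k' -> unramified_at q k.
Proof. by move=> kk' unr b /kk'; apply: unr. Qed.

Lemma prime_ndvd_4M (q d : nat) : prime q -> q != 2%N -> ~~ (q %| d)%N -> ~~ (q %| 4 * d)%N.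
Proof.
move=> q_pr q2 qd; rewrite Euclid_dvdM // negb_or qd andbT.
by rewrite (Euclid_dvdX 2 2) // andbT dvdn_prime2.
Qed.

(** * Relative norms, computed up to sign *)

Definition nrm (g : {rmorphism algC -> algC}) (t : algC) : algC := t * g t.

Section Norm.
Variable g : {rmorphism algC -> algC}.

(* [nrm g a] is [b] up to sign. *)
Definition nrm_pm a b : Prop := nrm g a ^+ 2 = b ^+ 2.

Lemma nrm_pmM a a' b b' : nrm_pm a b -> nrm_pm a' b' -> nrm_pm (a * a') (b * b').
Proof. by rewrite /nrm_pm => E E'; rewrite [RHS]exprMn -E -E' /nrm rmorphM; ring. Qed.

Lemma nrm_pmX a b n : nrm_pm a b -> nrm_pm (a ^+ n) (b ^+ n).
Proof. by rewrite /nrm_pm => E; rewrite [RHS]exprAC -E /nrm rmorphXn -exprMn exprAC. Qed.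

Lemma nrm_pm_expr0 a b (n : bool) : n = false -> nrm_pm (a ^+ n) (b ^+ n).
Proof. by move=> ->; rewrite /nrm_pm /nrm !expr0 rmorph1 mulr1. Qed.

(** If [g] fixes [a ^+ 2], it sends [a] to [a] or [- a]. *)
Lemma nrm_pm_sqr a : g (a ^+ 2) = a ^+ 2 -> nrm_pm a (a ^+ 2).
Proof. by move=> ga; rewrite /nrm_pm /nrm exprMn -rmorphXn /= ga [RHS]expr2. Qed.

Lemma nrm_pm_fixed d e : fundamental_unit d e ->
  g (sqrt_nat d) = sqrt_nat d -> nrm_pm e (e ^+ 2).
Proof.
by move=> fe gd; apply: nrm_pm_sqr; rewrite rmorphXn /= (Qsqrt_fix gd (fund_Q fe)).
Qed.

Lemma nrm_pm_neg d e : fundamental_unit d e -> neg_conj d e ->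
  g (sqrt_nat d) = - sqrt_nat d -> nrm_pm e 1.
Proof.
move=> fe ne gd; rewrite /nrm_pm /nrm (ne g gd) mulrN sqrrN divff //.
exact: Aunit_neq0 (fund_Aunit fe).
Qed.

Lemma nrm_sqrt w : nrm g w ^+ 2 = nrm g (w ^+ 2).
Proof. by rewrite /nrm rmorphXn exprMn. Qed.

Lemma nrm_pm_pos_sqrt d e W : fundamental_unit d e -> pos_conj d e ->
  W ^+ 2 = e -> g (sqrt_nat d) = - sqrt_nat d -> nrm_pm W 1.
Proof.
move=> fe ce WE gd; rewrite /nrm_pm nrm_sqrt WE /nrm (ce g gd) divff ?expr1n //.
exact: Aunit_neq0 (fund_Aunit fe).
Qed.

(** When [n] holds, the signs of the norms of [e] and [e'] cancel, so [W ^+ 2] has norm [e2 ^+ 2].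
    Otherwise [W ^+ 2 = e'] has norm 1. *)
Lemma nrm_pm_line_sqrt (n : bool) d e2 e e' W :
  fundamental_unit 2 e2 -> fundamental_unit d e -> neg_conj d e ->
  fundamental_unit (2 * d) e' ->
  (if n then neg_conj (2 * d) e' /\ W ^+ 2 = e2 * e * e'
   else pos_conj (2 * d) e' /\ W ^+ 2 = e') ->
  g (sqrt_nat 2) = sqrt_nat 2 -> g (sqrt_nat d) = - sqrt_nat d -> nrm_pm W (e2 ^+ n).
Proof.
move=> f2 fe ce fe' We g2 gd.
have g2d : g (sqrt_nat (2 * d)) = - sqrt_nat (2 * d).
  by rewrite sqrt_natM rmorphM /= g2 gd mulrN.
case: n We => [[ce' WE]|[ce' WE]]; last exact: nrm_pm_pos_sqrt fe' ce' WE g2d.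
rewrite /nrm_pm nrm_sqrt WE /nrm !rmorphM /= (Qsqrt_fix g2 (fund_Q f2)) (ce g gd) (ce' g g2d).
have e0 := Aunit_neq0 (fund_Aunit fe); have e0' := Aunit_neq0 (fund_Aunit fe').
by field; rewrite e0 e0'.
Qed.

Lemma nrm_pm_line_fixed (n : bool) d e2 e e' W :
  fundamental_unit 2 e2 -> fundamental_unit d e -> fundamental_unit (2 * d) e' ->
  (if n then neg_conj (2 * d) e' /\ W ^+ 2 = e2 * e * e'
   else pos_conj (2 * d) e' /\ W ^+ 2 = e') ->
  g (sqrt_nat 2) = sqrt_nat 2 -> g (sqrt_nat d) = sqrt_nat d -> nrm_pm W (W ^+ 2).
Proof.
move=> f2 fe fe' We g2 gd; apply: nrm_pm_sqr.
have g2d : g (sqrt_nat (2 * d)) = sqrt_nat (2 * d) by rewrite sqrt_natM rmorphM /= g2 gd.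
by case: n We => [[_ ->]|[_ ->]]; rewrite ?rmorphM /= ?(Qsqrt_fix g2 (fund_Q f2))
  ?(Qsqrt_fix gd (fund_Q fe)) ?(Qsqrt_fix g2d (fund_Q fe')).
Qed.

End Norm.

(* The square root of [e] is [r] times [sqrt 2] or [sqrt q] with [r] in the
   quadratic field: the other two possibilities are excluded because [e] is
   fundamental and because [p] is unramified in that field. *)
Lemma pos_sqrt_moved p q e W (g nu : {rmorphism algC -> algC}) :
  prime p -> prime q -> p != q -> p != 2%N ->
  fundamental_unit (2 * q) e ->
  Qadjoin [:: sqrt_nat 2; sqrt_nat p; sqrt_nat q] W -> W ^+ 2 = e ->
  g (sqrt_nat p) = sqrt_nat p -> g (sqrt_nat 2) = - sqrt_nat 2 ->
  g (sqrt_nat q) = - sqrt_nat q ->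
  nu (sqrt_nat 2) = - sqrt_nat 2 -> nu (sqrt_nat q) = sqrt_nat q ->
  g W <> W.
Proof.
move=> pp pq npq np2 fe KW W2 gp g2 gq nu2 nuq gW.
pose k := Qsqrt (2 * q).
have kF : subfield_pred k by apply: subfield_Qadjoin.
have kn n : k (sqrt_nat n ^+ 2) by rewrite sqrt_natK; apply: subfield_nat.
pose k' := adj k (sqrt_nat p).
have kF' : subfield_pred k' by apply: subfield_adj.
have kn' n : k' (sqrt_nat n ^+ 2) by apply: adj_base.
have kq : k (sqrt_nat (2 * q)) by apply: Qadjoin_gen; rewrite mem_head.
have KW' : adj k' (sqrt_nat 2) W.
  have F := subfield_adj kF' (kn' 2).
  apply: (Qadjoin_min F) KW => y; rewrite !inE => /or3P[] /eqP->.
  - exact: adj_gen.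
  - by apply: adj_base => //; apply: adj_gen.
  have -> : sqrt_nat q = sqrt_nat (2 * q) / sqrt_nat 2.
    by rewrite sqrt_natM mulrC mulKf // sqrt_nat_neq0.
  apply: subfield_div => //; last exact: adj_gen.
  by do 2!apply: adj_base => //.
have gk x : k x -> g x = x.
  by apply: Qsqrt_fix; rewrite sqrt_natM rmorphM /= g2 gq mulrNN.
have gk' x : k' x -> g x = x.
  by case=> a [b [ka kb ->]]; rewrite rmorphD rmorphM /= gp !gk.
have kW := flip_fixed gk' g2 KW' gW.
have ke : k (W ^+ 2) by rewrite W2; apply: fund_Q fe.
case: (adj_sqr kF (kn p) kW ke) => [kW0|kWp]; first exact: (fund_nonsquare fe kW0 W2).
have unr : unramified_at p k.
  apply: (@unramified_sub _ _ (adj (fun z => z \in Crat) (sqrt_nat (2 * q)))).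
    by move=> x /Qsqrt_adj.
  apply: (@unramified_adj_sqrt p _ (2 * q) nu) => //.
  - exact: subfield_rat.
  - exact: unramified_rat.
  - exact: aut_Crat.
  - by rewrite sqrt_natM rmorphM /= nu2 nuq mulNr.
  - by rewrite prime_ndvd_4M // Euclid_dvdM // !dvdn_prime2 // negb_or np2.
(* If [W * sqrt p] were in [k], its square [p * e] would force [p ^ 2] to divide [p]. *)
have := unramified_sqr (m := p) pp unr (fund_Aunit fe) kWp.
rewrite exprMn W2 sqrt_natK mulrC => /(_ erefl (dvdnn p)) /dvdn_leq.
by rewrite prime_gt0 // => /(_ isT); rewrite leqNgt -{1}[p]expn1 ltn_exp2l // prime_gt1.
Qed.

(** * The field [K] and the automorphisms [x], [y], [z] flipping one square root each *)

Section Triquadratic.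
Variables (p q : nat) (x y z : {rmorphism algC -> algC}).
Variables (e2 ep eqq e2p e2q epq e2pq : algC).
Hypotheses (p_pr : prime p) (q_pr : prime q) (p_neq_q : p != q).
Hypotheses (p_neq2 : p != 2%N) (q_neq2 : q != 2%N).
Local Notation s2 := (sqrt_nat 2).
Local Notation sp := (sqrt_nat p).
Local Notation sq := (sqrt_nat q).
Hypotheses (x2 : x s2 = - s2) (xp : x sp = sp) (xq : x sq = sq).
Hypotheses (y2 : y s2 = s2) (yp : y sp = - sp) (yq : y sq = sq).
Hypotheses (z2 : z s2 = s2) (zp : z sp = sp) (zq : z sq = - sq).
Hypotheses (f2 : fundamental_unit 2 e2) (fp : fundamental_unit p ep)
  (fq : fundamental_unit q eqq) (f2p : fundamental_unit (2 * p) e2p)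
  (f2q : fundamental_unit (2 * q) e2q) (fpq : fundamental_unit (p * q) epq)
  (f2pq : fundamental_unit (2 * (p * q)) e2pq).
Hypotheses (c2 : neg_conj 2 e2) (cp : neg_conj p ep) (cq : neg_conj q eqq)
  (cpq : neg_conj (p * q) epq) (c2pq : neg_conj (2 * (p * q)) e2pq).

Local Notation K := (Qadjoin [:: s2; sp; sq]).

Let KF : subfield_pred K. Proof. exact: subfield_Qadjoin. Qed.

Let Ks2 : K s2. Proof. by apply: Qadjoin_gen; rewrite !inE eqxx. Qed.
Let Ksp : K sp. Proof. by apply: Qadjoin_gen; rewrite !inE eqxx orbT. Qed.
Let Ksq : K sq. Proof. by apply: Qadjoin_gen; rewrite !inE eqxx !orbT. Qed.

Let Qsqrt_K d u : K (sqrt_nat d) -> Qsqrt d u -> K u.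
Proof. by move=> Kd; apply: Qadjoin_min => // g; rewrite inE => /eqP->. Qed.

Let Ke2 : K e2. Proof. by apply: Qsqrt_K (fund_Q f2). Qed.
Let Kep : K ep. Proof. by apply: Qsqrt_K (fund_Q fp). Qed.
Let Keq : K eqq. Proof. by apply: Qsqrt_K (fund_Q fq). Qed.
Let Ke2p : K e2p.
Proof. by apply: Qsqrt_K (fund_Q f2p); rewrite sqrt_natM; apply: subfieldM. Qed.
Let Ke2q : K e2q.
Proof. by apply: Qsqrt_K (fund_Q f2q); rewrite sqrt_natM; apply: subfieldM. Qed.
Let Ksqrt_pq : K (sqrt_nat (p * q)). Proof. by rewrite sqrt_natM; apply: subfieldM. Qed.
Let Kepq : K epq. Proof. by apply: Qsqrt_K (fund_Q fpq). Qed.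

(** The primes 2, [p], [q] have their square roots in [K]. Any other prime divides none of [4 * 2],
    [4 * p], [4 * q], and so stays unramified along the tower of three quadratic steps. *)
Lemma K3_tame : tame K.
Proof.
move=> r r_pr.
have [->|r2] := eqVneq r 2%N; first by left.
have [->|rp] := eqVneq r p; first by left.
have [->|rq] := eqVneq r q; [by left | right].
have sqr_in k n : subfield_pred k -> k (sqrt_nat n ^+ 2).
  by move=> kF; rewrite sqrt_natK; apply: subfield_nat.
have F1 := subfield_adj subfield_rat (sqr_in _ 2%N subfield_rat).
have F2 := subfield_adj F1 (sqr_in _ p F1).
have F3 := subfield_adj F2 (sqr_in _ q F2).
have nd n : prime n -> r != n -> ~~ (r %| 4 * n)%N.
  by move=> n_pr rn; rewrite prime_ndvd_4M // dvdn_prime2.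
apply: (@unramified_sub r _ (adj (adj (adj (fun z => z \in Crat) s2) sp) sq)).
  move=> t; apply: (Qadjoin_min F3) => g; rewrite !inE => /or3P[] /eqP->.
  - by do 2!apply: adj_base => //; apply: adj_gen subfield_rat.
  - by apply: adj_base => //; apply: adj_gen.
  - exact: adj_gen.
have fix1 (g : {rmorphism algC -> algC}) k s : g s = s -> (forall t, k t -> g t = t) ->
    forall t, adj k s t -> g t = t.
  by move=> gs gk t [a [b [ka kb ->]]]; rewrite rmorphD rmorphM /= gs !gk.
have xQ t : t \in Crat -> x t = t by apply: aut_Crat.
have u1 := unramified_adj_sqrt r_pr subfield_rat (unramified_rat r_pr) xQ x2 (nd 2%N isT r2).
have y1 := fix1 y (fun z => z \in Crat) s2 y2 (@aut_Crat y).
have u2 := unramified_adj_sqrt r_pr F1 u1 y1 yp (nd p p_pr rp).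
have z1 := fix1 z _ sp zp (fix1 z (fun z => z \in Crat) s2 z2 (@aut_Crat z)).
exact: unramified_adj_sqrt r_pr F2 u2 z1 zq (nd q q_pr rq).
Qed.

Let K_stable (g : {rmorphism algC -> algC}) :
  K (g s2) -> K (g sp) -> K (g sq) -> forall u, K u -> K (g u).
Proof.
by move=> g2 gp gq u; apply: Qadjoin_stable => v; rewrite !inE => /or3P[] /eqP->.
Qed.

Let Kx u : K u -> K (x u).
Proof. by apply: K_stable; rewrite ?x2 ?xp ?xq //; apply: subfieldN. Qed.
Let Ky u : K u -> K (y u).
Proof. by apply: K_stable; rewrite ?y2 ?yp ?yq //; apply: subfieldN. Qed.
Let Kz u : K u -> K (z u).
Proof. by apply: K_stable; rewrite ?z2 ?zp ?zq //; apply: subfieldN. Qed.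

Let K_real u : K u -> u \is Num.real.
Proof.
by apply: real_Qadjoin => g; rewrite !inE => /or3P[] /eqP->; apply: sqrt_nat_real.
Qed.

Let K_sqr_gt0 u : K u -> u != 0 -> 0 < u ^+ 2.
Proof. by move=> /K_real; apply: real_sqr_gt0. Qed.

Let K_sqr_conj_gt0 (g : {rmorphism algC -> algC}) u :
  K (g u) -> u != 0 -> 0 < g (u ^+ 2).
Proof. by move=> Kgu u0; rewrite rmorphXn; apply: K_sqr_gt0; rewrite ?fmorph_eq0. Qed.

Let quad_sqr a b n : Qadjoin [:: a; b] (sqrt_nat n ^+ 2).
Proof. by rewrite sqrt_natK; apply: subfield_nat; apply: subfield_Qadjoin. Qed.

Let adj_quadF a b n : subfield_pred (adj (Qadjoin [:: a; b]) (sqrt_nat n)).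
Proof. by apply: subfield_adj; [apply: subfield_Qadjoin | apply: quad_sqr]. Qed.

Let in_quad1 a b : Qadjoin [:: a; b] a.
Proof. by apply: Qadjoin_gen; rewrite !inE eqxx. Qed.
Let in_quad2 a b : Qadjoin [:: a; b] b.
Proof. by apply: Qadjoin_gen; rewrite !inE eqxx orbT. Qed.

Let quadF a b : subfield_pred (Qadjoin [:: a; b]).
Proof. exact: subfield_Qadjoin. Qed.

Let quad_fix (g : {rmorphism algC -> algC}) a b : g a = a -> g b = b ->
  forall u, Qadjoin [:: a; b] u -> g u = u.
Proof. by move=> ga gb u; apply: aut_fix_Qadjoin => v; rewrite !inE => /orP[] /eqP->. Qed.

Let K_adj_q u : K u -> adj (Qadjoin [:: s2; sp]) sq u.
Proof.
apply: Qadjoin_min => // g; rewrite !inE => /or3P[] /eqP->; last exact: adj_gen.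
  by apply: adj_base.
by apply: adj_base.
Qed.

Let K_adj_p u : K u -> adj (Qadjoin [:: s2; sq]) sp u.
Proof.
by apply: Qadjoin_min => // g; rewrite !inE => /or3P[] /eqP->;
  [apply: adj_base | apply: adj_gen | apply: adj_base].
Qed.

Let K_adj_pq u : K u -> adj (Qadjoin [:: s2; sqrt_nat (p * q)]) sp u.
Proof.
apply: Qadjoin_min => // g; rewrite !inE => /or3P[] /eqP->.
- exact: adj_base.
- exact: adj_gen.
have -> : sq = sqrt_nat (p * q) / sp.
  by rewrite sqrt_natM mulrC mulKf // sqrt_nat_neq0 // prime_gt0.
by apply: subfield_div => //; [apply: adj_base | apply: adj_gen].
Qed.

Definition yz : {rmorphism algC -> algC} := y \o z.

Lemma norm_k3 u : K u -> Qadjoin [:: s2; sqrt_nat (p * q)] (u * yz u).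
Proof.
move=> Ku; apply: flip_norm (K_adj_pq Ku) => //.
  by apply: quad_fix; rewrite /= ?z2 ?y2 // sqrt_natM !rmorphM /= zp zq !rmorphN /= yp yq mulrNN.
by rewrite /= zp yp.
Qed.

Let yyK u : K u -> y (y u) = u.
Proof. by move=> /K_adj_p; apply: (flip_invol (quad_fix y2 yq) yp). Qed.

(** * The square roots [W1] to [W4]; [n1] and [n2] are true for norm -1 *)

Variables (n1 n2 : bool) (W1 W2 W3 W4 : algC).
Hypotheses (W1_gt0 : 0 < W1) (W2_gt0 : 0 < W2) (W3_gt0 : 0 < W3).
Hypotheses
  (W1E : if n1 then neg_conj (2 * p) e2p /\ W1 ^+ 2 = e2 * ep * e2p
         else pos_conj (2 * p) e2p /\ W1 ^+ 2 = e2p)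
  (W2E : if n2 then neg_conj (2 * q) e2q /\ W2 ^+ 2 = e2 * eqq * e2q
         else pos_conj (2 * q) e2q /\ W2 ^+ 2 = e2q)
  (W3E : W3 ^+ 2 = e2 * epq * e2pq) (W4E : W4 ^+ 2 = ep * eqq * epq).


Let ypq : y (sqrt_nat (p * q)) = - sqrt_nat (p * q).
Proof. by rewrite sqrt_natM rmorphM /= yp yq mulNr. Qed.
Let zpq : z (sqrt_nat (p * q)) = - sqrt_nat (p * q).
Proof. by rewrite sqrt_natM rmorphM /= zp zq mulrN. Qed.
Let xpq : x (sqrt_nat (p * q)) = sqrt_nat (p * q).
Proof. by rewrite sqrt_natM rmorphM /= xp xq. Qed.

Lemma KW1 : K W1.
Proof.
suff [w Kw w2] : exists2 w, K w & w ^+ 2 = W1 ^+ 2 by apply: (subfield_sqr_root KF Kw).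
move: W1E; case: n1 => [[c2p ->]|[c2p ->]].
  exact: (neg_line_sqrt f2 fp f2p y2 yp x2 xp c2 cp KF K3_tame).
apply: (pos_conj_sqrt (nu := x) KF K3_tame f2p) => //.
  by rewrite sqrt_natM rmorphM /= x2 xp mulNr.
by apply: c2p; rewrite sqrt_natM rmorphM /= x2 xp mulNr.
Qed.

Lemma KW2 : K W2.
Proof.
suff [w Kw w2] : exists2 w, K w & w ^+ 2 = W2 ^+ 2 by apply: (subfield_sqr_root KF Kw).
move: W2E; case: n2 => [[c2q ->]|[c2q ->]].
  exact: (neg_line_sqrt f2 fq f2q z2 zq x2 xq c2 cq KF K3_tame).
apply: (pos_conj_sqrt (nu := x) KF K3_tame f2q) => //.
  by rewrite sqrt_natM rmorphM /= x2 xq mulNr.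
by apply: c2q; rewrite sqrt_natM rmorphM /= x2 xq mulNr.
Qed.

Lemma KW3 : K W3.
Proof.
suff [w Kw w2] : exists2 w, K w & w ^+ 2 = W3 ^+ 2 by apply: (subfield_sqr_root KF Kw).
rewrite W3E; exact: (neg_line_sqrt f2 fpq f2pq y2 ypq x2 xpq c2 cpq KF K3_tame).
Qed.

Lemma KW4 : K W4.
Proof.
suff [w Kw w2] : exists2 w, K w & w ^+ 2 = W4 ^+ 2 by apply: (subfield_sqr_root KF Kw).
rewrite W4E; exact: (neg_line_sqrt fp fq fpq zp zq yp yq cp cq KF K3_tame).
Qed.

Let We n d e e' e'' W : (if n then neg_conj d e /\ W ^+ 2 = e' * e'' * e
   else pos_conj d e /\ W ^+ 2 = e) ->
  (neg_conj d e /\ W ^+ 2 = e' * e'' * e) \/ (pos_conj d e /\ W ^+ 2 = e).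
Proof. by case: n; [left | right]. Qed.

(** * Decomposition of the units of [K] *)

Definition Tgens := [:: -1; e2; ep; eqq; epq; W1; W2; W3].

Lemma unit_sqr_span u : K u -> Aunit u -> mul_span Tgens (u ^+ 2).
Proof.
move=> Ku uU.
have U (g : {rmorphism algC -> algC}) : Aunit (u * g u) by apply: AunitM => //; apply: Aunit_aut.
have N1 : Qadjoin [:: s2; sp] (u * z u).
  by apply: flip_norm (K_adj_q Ku) => //; apply: quad_fix.
have N2 : Qadjoin [:: s2; sq] (u * y u).
  by apply: flip_norm (K_adj_p Ku) => //; apply: quad_fix.
have N3 : Qadjoin [:: s2; sqrt_nat (p * q)] (y (u * yz u)).
  apply: Qadjoin_stable (norm_k3 Ku) => v; rewrite !inE => /orP[] /eqP->.
    by rewrite y2.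
  by rewrite ypq; apply: subfieldN.
have S1 := line_unit (isT : (0 < 2)%N) f2 fp f2p y2 yp x2 xp c2 cp N1 (U z) (We W1E).
have S2 := line_unit (isT : (0 < 2)%N) f2 fq f2q z2 zq x2 xq c2 cq N2 (U y) (We W2E).
have S3 := line_unit (isT : (0 < 2)%N) f2 fpq f2pq y2 ypq x2 xpq c2 cpq N3 (Aunit_aut y (U yz))
  (or_introl (conj c2pq W3E)).
(* Applying [y] to the third norm turns it into [y u * z u], which cancels the unwanted conjugates
   of the other two. *)
have -> : u ^+ 2 = (u * z u) * (u * y u) / y (u * yz u).
  rewrite rmorphM /= yyK; last exact: Kz.
  have u0 := Aunit_neq0 uU; field.
  by rewrite !fmorph_eq0 u0.
apply: mul_span_div; first apply: mul_spanM.
- by apply: mul_span_sub S1 => v vS; apply: mul_span_gen; move: vS; rewrite !inE;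
  do 3?[case/orP]; move/eqP->; rewrite eqxx ?orbT.
- by apply: mul_span_sub S2 => v vS; apply: mul_span_gen; move: vS; rewrite !inE;
  do 3?[case/orP]; move/eqP->; rewrite eqxx ?orbT.
- by apply: mul_span_sub S3 => v vS; apply: mul_span_gen; move: vS; rewrite !inE;
  do 3?[case/orP]; move/eqP->; rewrite eqxx ?orbT.
Qed.

Let e2_gt0 := fund_gt0 f2.
Let ep_gt0 := fund_gt0 fp.
Let eq_gt0 := fund_gt0 fq.
Let epq_gt0 := fund_gt0 fpq.

(* [e2] is not a square in [K] because its conjugate under [x] is negative. *)
Lemma norm_e2_even (g : {rmorphism algC -> algC}) u C n : K u -> K (g u) -> u != 0 ->
  K C -> 0 < C -> nrm g (u ^+ 2) ^+ 2 = (C ^+ 2 * e2 ^+ n) ^+ 2 -> ~~ odd n.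
Proof.
move=> Ku Kgu u0 KC C0 NE; apply/negP=> n_odd.
set v := nrm g u.
have Kv : K v by apply: subfieldM.
have v0 : v != 0 by rewrite mulf_neq0 ?fmorph_eq0.
have v2 : v ^+ 2 = C ^+ 2 * e2 ^+ n.
  apply: sqr_pos_inj; first exact: K_sqr_gt0.
    by rewrite mulr_gt0 // exprn_gt0.
  by rewrite -NE; congr (_ ^+ 2); rewrite /v /nrm rmorphXn exprMn.
have C0' : C != 0 by rewrite gt_eqF.
have e0 : e2 != 0 by rewrite gt_eqF.
pose r := v / (C * e2 ^+ n./2).
have Kr : K r by apply: subfield_div => //; apply: subfieldM => //; apply: subfieldX.
have r0 : r != 0 by rewrite mulf_neq0 // invr_eq0 mulf_neq0 // expf_neq0.
have r2 : r ^+ 2 = e2.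
  rewrite /r expr_div_n v2 -{1}(odd_double_half n) n_odd exprMn -exprM muln2.
  rewrite exprD expr1; field; by rewrite C0' expf_neq0.
have := K_sqr_conj_gt0 (Kx Kr) r0; rewrite r2 (c2 x2) oppr_gt0.
have eV : 0 < e2^-1 by rewrite invr_gt0.
by move=> H; have := lt_trans H eV; rewrite ltxx.
Qed.

(** Up to sign the norm [u * g u] equals [C * W]. It is fixed by the involution [g], as is [C], so
    [W] is fixed too. *)
Lemma norm_fixes (g : {rmorphism algC -> algC}) u C W : K u -> K (g u) -> u != 0 ->
  g (g u) = u -> 0 < C -> g C = C -> 0 < W ->
  nrm g (u ^+ 2) ^+ 2 = (C ^+ 2 * W ^+ 2) ^+ 2 -> g W = W.
Proof.
move=> Ku Kgu u0 ggu C0 gC W0 NE.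
have /eqP : (u * g u) ^+ 2 = (C * W) ^+ 2.
  apply: sqr_pos_inj.
  - by apply: K_sqr_gt0; [apply: subfieldM | rewrite mulf_neq0 ?fmorph_eq0].
  - by rewrite exprn_gt0 ?mulr_gt0.
  by rewrite [(C * W) ^+ 2]exprMn -NE; congr (_ ^+ 2); rewrite /nrm rmorphXn exprMn.
have gv : g (u * g u) = u * g u by rewrite rmorphM /= ggu mulrC.
have C0' : C != 0 by rewrite gt_eqF.
rewrite eqf_sqr => /orP[] /eqP vE; move: gv; rewrite vE ?rmorphN rmorphM /= gC.
  by move/(mulfI C0').
by move/oppr_inj/(mulfI C0').
Qed.

Let K_invol (g : {rmorphism algC -> algC}) :
  g (g s2) = s2 -> g (g sp) = sp -> g (g sq) = sq -> forall u, K u -> g (g u) = u.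
Proof.
move=> g2 gp gq u; apply: (@aut_fix_Qadjoin (g \o g : {rmorphism algC -> algC})) => v.
by rewrite !inE => /or3P[] /eqP->.
Qed.

Let nz v : 0 < v -> v != 0 :> algC. Proof. by move=> v0; rewrite gt_eqF. Qed.

Let Vp n (e : algC) : 0 < e -> 0 < e^-1 ^+ n.
Proof. by move=> e0; rewrite exprn_gt0 // invr_gt0. Qed.

(** Modulo squares, positivity of the square and of its conjugates under [x], [y], [z] leaves only
    the powers of [ep * eqq * epq], which is [W4 ^+ 2]. *)
Lemma sqr_eps_span r : K r -> r != 0 ->
  mul_span [:: -1; e2; ep; eqq; epq] (r ^+ 2) -> mul_span [:: -1; e2; ep; eqq; W4] r.
Proof.
move=> Kr r0 /mul_span_mod_sqr[].
  move=> v; rewrite !inE; do 4?[case/orP]; move/eqP->; rewrite ?oppr_eq0 ?oner_neq0 //;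
  exact: nz.
move=> t [bs [szb St rE]].
case: bs szb rE => [|s [|a [|b [|c [|d [|? ?]]]]]] //= _.
rewrite !big_cons big_nil /= mulr1 => rE.
have t0 : t != 0.
  by apply: contraNneq r0 => t0; rewrite -sqrf_eq0 rE t0 expr0n mul0r.
have Kt : K t.
  apply: (subfield_span KF) St => v; rewrite !inE; do 4?[case/orP]; move/eqP-> => //.
  by apply: (subfieldN KF); apply: subfield1.
pose r' := r / t.
have Kr' : K r' by apply: subfield_div.
have r0' : r' != 0 by rewrite mulf_neq0 ?invr_eq0.
have r2 : r' ^+ 2 = (-1) ^+ s * (e2 ^+ a * (ep ^+ b * (eqq ^+ c * epq ^+ d))).
  by rewrite expr_div_n rE mulrAC divff ?mul1r // expf_neq0.
have sE : s = false.
  apply: (@sign_gt0 _ (e2 ^+ a * (ep ^+ b * (eqq ^+ c * epq ^+ d)))).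
    by rewrite !mulr_gt0 ?exprn_gt0.
  by rewrite -r2; apply: K_sqr_gt0.
rewrite sE mul1r in r2.
have aE : a = false.
  apply: (@sign_gt0 _ (e2^-1 ^+ a * (ep ^+ b * (eqq ^+ c * epq ^+ d)))).
    by rewrite !mulr_gt0 ?Vp ?exprn_gt0.
  have := K_sqr_conj_gt0 (Kx Kr') r0'; rewrite r2 !rmorphM !rmorphXn /=.
  rewrite (c2 x2) (Qsqrt_fix xp (fund_Q fp)) (Qsqrt_fix xq (fund_Q fq)).
  by rewrite (Qsqrt_fix xpq (fund_Q fpq)) [(- e2^-1) ^+ _]exprNn -mulrA.
have bE : b (+) d = false.
  apply: (@sign_gt0 _ (e2 ^+ a * (ep^-1 ^+ b * (eqq ^+ c * epq^-1 ^+ d)))).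
    by rewrite !mulr_gt0 ?Vp ?exprn_gt0.
  have := K_sqr_conj_gt0 (Ky Kr') r0'; rewrite r2 !rmorphM !rmorphXn /=.
  rewrite (cp yp) (cpq ypq) (Qsqrt_fix y2 (fund_Q f2)) (Qsqrt_fix yq (fund_Q fq)).
  rewrite [(- ep^-1) ^+ _]exprNn [(- epq^-1) ^+ _]exprNn signr_addb.
  by congr (0 < _); ring.
have cE : c (+) d = false.
  apply: (@sign_gt0 _ (e2 ^+ a * (ep ^+ b * (eqq^-1 ^+ c * epq^-1 ^+ d)))).
    by rewrite !mulr_gt0 ?Vp ?exprn_gt0.
  have := K_sqr_conj_gt0 (Kz Kr') r0'; rewrite r2 !rmorphM !rmorphXn /=.
  rewrite (cq zq) (cpq zpq) (Qsqrt_fix z2 (fund_Q f2)) (Qsqrt_fix zp (fund_Q fp)).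
  rewrite [(- eqq^-1) ^+ _]exprNn [(- epq^-1) ^+ _]exprNn signr_addb.
  by congr (0 < _); ring.
have {}bE : b = d by apply/eqP; rewrite -negb_add bE.
have {}cE : c = d by apply/eqP; rewrite -negb_add cE.
set S := [:: -1; e2; ep; eqq; W4].
have SW : mul_span S W4 by apply: mul_span_gen; rewrite !inE eqxx !orbT.
have Sg v : v \in [:: -1; e2; ep; eqq] -> mul_span S v.
  move=> vS; apply: mul_span_gen; move: vS; rewrite !inE.
  by case/or4P=> ->; rewrite ?orbT.
have -> : r = t * r' by rewrite mulrC divfK.
apply: mul_spanM.
  apply: mul_span_sub St => v; rewrite !inE; do 4?[case/orP]; move/eqP->;
    try by apply: Sg; rewrite !inE eqxx ?orbT.
  have -> : epq = W4 ^+ 2 / (ep * eqq) by rewrite W4E mulrC mulKf // mulf_neq0 ?nz.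
  apply: mul_span_div; first exact: mul_spanX.
  by apply: mul_spanM; apply: Sg; rewrite !inE eqxx ?orbT.
apply: (@mul_span_sqr _ (W4 ^+ d)); first by rewrite mem_head.
  exact: mul_spanX.
by rewrite r2 aE bE cE exprAC W4E !exprMn; ring.
Qed.

Lemma Tgens_unit v : v \in Tgens -> K v /\ Aunit v.
Proof.
have U2 := fund_Aunit f2; have Up := fund_Aunit fp; have Uq := fund_Aunit fq.
have Upq := fund_Aunit fpq; have U2p := fund_Aunit f2p; have U2q := fund_Aunit f2q.
have U2pq := fund_Aunit f2pq.
have UW1 : Aunit W1.
  by apply: Aunit_sqrt; move: W1E; case: n1 => [[_ ->]|[_ ->]] //; do 2?[apply: AunitM].
have UW2 : Aunit W2.
  by apply: Aunit_sqrt; move: W2E; case: n2 => [[_ ->]|[_ ->]] //; do 2?[apply: AunitM].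
have UW3 : Aunit W3 by apply: Aunit_sqrt; rewrite W3E; do 2?[apply: AunitM].
have K1 : K (-1) by apply: (subfieldN KF); apply: subfield1.
by rewrite !inE; do 7?[case/orP]; move/eqP->; split=> //;
  [exact: AunitN1 | exact: KW1 | exact: KW2 | exact: KW3].
Qed.

(** Norms under [z] and [y] give parity conditions on the exponents [i], [j], [k] of [W1], [W2],
    [W3]. If [n1] and [n2] both hold they say [i = j = k], the common exponent [e]. Otherwise all
    three vanish, by a further norm for each root coming from a unit of norm 1. *)
Lemma unit_decomp u : K u -> Aunit u ->
  exists t u' (a b c d e : bool),
    [/\ mul_span Tgens t, K u' /\ Aunit u', u = t * u',
        u' ^+ 2 = e2 ^+ a * ep ^+ b * eqq ^+ c * epq ^+ d * (W1 * W2 * W3) ^+ e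
      & e -> n1 && n2].
Proof.
move=> Ku uU.
have [|t [bs [szb St uE]]] := mul_span_mod_sqr _ (unit_sqr_span Ku uU).
  by move=> v /Tgens_unit[_ /Aunit_neq0].
case: bs szb uE => [|s [|a [|b [|c [|d [|i [|j [|k [|? ?]]]]]]]]] //= _.
rewrite !big_cons big_nil /= mulr1 => uE.
have Kt : K t by apply: (subfield_span KF) St => v /Tgens_unit[].
have tU : Aunit t by apply: Aunit_span St => v /Tgens_unit[].
have t0 := Aunit_neq0 tU.
pose u' := u / t.
have Ku' : K u' by apply: subfield_div.
have uU' : Aunit u' by apply: AunitM => //; apply: AunitV.
have u0' := Aunit_neq0 uU'.
have u2 : u' ^+ 2 = (-1) ^+ s * (e2 ^+ a * (ep ^+ b * (eqq ^+ c * (epq ^+ d *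
    (W1 ^+ i * (W2 ^+ j * W3 ^+ k)))))).
  by rewrite expr_div_n uE mulrAC divff ?mul1r // expf_neq0.
have sE : s = false.
  apply: (sign_gt0 _ (t := (e2 ^+ a * (ep ^+ b * (eqq ^+ c * (epq ^+ d *
    (W1 ^+ i * (W2 ^+ j * W3 ^+ k)))))))).
    by rewrite !mulr_gt0 ?exprn_gt0.
  by rewrite -u2; apply: K_sqr_gt0.
rewrite sE mul1r {s sE uE} in u2.
have W3n : if true then neg_conj (2 * (p * q)) e2pq /\ W3 ^+ 2 = e2 * epq * e2pq
           else pos_conj (2 * (p * q)) e2pq /\ W3 ^+ 2 = e2pq by [].
have nrmE (g : {rmorphism algC -> algC}) A2 Ap Aq Apq B1 B2 B3 :
    nrm_pm g e2 A2 -> nrm_pm g ep Ap -> nrm_pm g eqq Aq -> nrm_pm g epq Apq ->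
    nrm_pm g (W1 ^+ i) (B1 ^+ i) -> nrm_pm g (W2 ^+ j) (B2 ^+ j) ->
    nrm_pm g (W3 ^+ k) (B3 ^+ k) ->
    nrm g (u' ^+ 2) ^+ 2 = (A2 ^+ a * (Ap ^+ b * (Aq ^+ c * (Apq ^+ d *
      (B1 ^+ i * (B2 ^+ j * B3 ^+ k)))))) ^+ 2.
  by move=> *; rewrite u2; do !apply: nrm_pmM => //; apply: nrm_pmX.
(* The norm under [z] is a square times [e2 ^+ (n2 * j + k)] up to sign: [W3] contributes [e2], and
   [W2] does so exactly when [n2] holds. *)
have jk : ~~ odd (n2 * j + k).
  apply: (@norm_e2_even z u' (e2 ^+ a * ep ^+ b * W1 ^+ i)) => //; first exact: Kz.
  - by do 2?[apply: subfieldM => //]; apply: subfieldX => //; apply: KW1.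
  - by rewrite !mulr_gt0 ?exprn_gt0.
  rewrite (nrmE z (e2 ^+ 2) (ep ^+ 2) 1 1 (W1 ^+ 2) (e2 ^+ n2) (e2 ^+ true)).
  - congr (_ ^+ 2); rewrite !expr1n exprD exprM expr1.
    by rewrite [(e2 ^+ 2) ^+ a]exprAC [(ep ^+ 2) ^+ b]exprAC [(W1 ^+ 2) ^+ i]exprAC; ring.
  - exact: nrm_pm_fixed f2 z2.
  - exact: nrm_pm_fixed fp zp.
  - exact: nrm_pm_neg fq cq zq.
  - exact: nrm_pm_neg fpq cpq zpq.
  - by apply: nrm_pmX; apply: nrm_pm_line_fixed f2 fp f2p W1E z2 zp.
  - by apply: nrm_pmX; apply: nrm_pm_line_sqrt f2 fq cq f2q W2E z2 zq.
  - by apply: nrm_pmX; apply: (@nrm_pm_line_sqrt z true (p * q)%N e2 epq e2pq).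
have ik : ~~ odd (n1 * i + k).
  apply: (@norm_e2_even y u' (e2 ^+ a * eqq ^+ c * W2 ^+ j)) => //; first exact: Ky.
  - by do 2?[apply: subfieldM => //]; apply: subfieldX => //; apply: KW2.
  - by rewrite !mulr_gt0 ?exprn_gt0.
  rewrite (nrmE y (e2 ^+ 2) 1 (eqq ^+ 2) 1 (e2 ^+ n1) (W2 ^+ 2) (e2 ^+ true)).
  - congr (_ ^+ 2); rewrite !expr1n exprD exprM expr1.
    by rewrite [(e2 ^+ 2) ^+ a]exprAC [(eqq ^+ 2) ^+ c]exprAC [(W2 ^+ 2) ^+ j]exprAC; ring.
  - exact: nrm_pm_fixed f2 y2.
  - exact: nrm_pm_neg fp cp yp.
  - exact: nrm_pm_fixed fq yq.
  - exact: nrm_pm_neg fpq cpq ypq.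
  - by apply: nrm_pmX; apply: nrm_pm_line_sqrt f2 fp cp f2p W1E y2 yp.
  - by apply: nrm_pmX; apply: nrm_pm_line_fixed f2 fq f2q W2E y2 yq.
  - by apply: nrm_pmX; apply: (@nrm_pm_line_sqrt y true (p * q)%N e2 epq e2pq).
have [n12|n12] := boolP (n1 && n2).
  have [n1t n2t] := andP n12.
  rewrite n1t mul1n oddD !oddb in ik; rewrite n2t mul1n oddD !oddb in jk.
  have iE : i = k by apply/eqP; rewrite -negb_add.
  have jE : j = k by apply/eqP; rewrite -negb_add.
  exists t, u', a, b, c, d, k; split=> //; first by rewrite mulrC divfK.
  by rewrite u2 iE jE !exprMn; ring.
have kE : k = false.
  by move: n12 ik jk; rewrite oddD oddM oddD oddM !oddb; case: (n1) (n2) (k) => [] [] [].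
have iE : n1 -> i = false.
  by move=> n1t; move: ik; rewrite kE n1t mul1n addn0 oddb => /negbTE.
have jE' : n2 -> j = false.
  by move=> n2t; move: jk; rewrite kE n2t mul1n addn0 oddb => /negbTE.
pose xz : {rmorphism algC -> algC} := x \o z.
pose xy : {rmorphism algC -> algC} := x \o y.
(* For [n2] false, [xz] fixes [sqrt p] and [sqrt (2 q)]. If [j] were 1, the norm under [xz] would
   show that [xz] fixes [W2], against [pos_sqrt_moved]. *)
have jE : j = false.
  apply/negP=> jt; have n2f : n2 = false by apply/negP=> /jE'; rewrite jt.
  have [c2q W2s] : pos_conj (2 * q) e2q /\ W2 ^+ 2 = e2q by move: W2E; rewrite n2f.
  have gs2 : xz s2 = - s2 by rewrite /= z2 x2.
  have gsp : xz sp = sp by rewrite /= zp xp.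
  have gsq : xz sq = - sq by rewrite /= zq rmorphN /= xq.
  apply: (@pos_sqrt_moved p q e2q W2 xz x) => //; first exact: KW2.
  apply: (@norm_fixes xz u' (ep ^+ b)) => //.
  - by apply/Kx/Kz.
  - by apply: K_invol => //; rewrite ?gs2 ?gsp ?gsq // rmorphN ?gs2 ?gsq opprK.
  - by rewrite exprn_gt0.
  - by rewrite rmorphXn; congr (_ ^+ b); apply: Qsqrt_fix gsp (fund_Q fp).
  rewrite (nrmE xz 1 (ep ^+ 2) 1 1 1 (W2 ^+ 2) 1).
  - by congr (_ ^+ 2); rewrite !expr1n jt exprAC; ring.
  - exact: nrm_pm_neg f2 c2 gs2.
  - exact: nrm_pm_fixed fp gsp.
  - exact: nrm_pm_neg fq cq gsq.
  - by apply: nrm_pm_neg fpq cpq _; rewrite sqrt_natM rmorphM gsp gsq mulrN.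
  - have [/iE iF|/negbTE n1f] := boolP n1; first exact: nrm_pm_expr0.
    have [c2p W1s] : pos_conj (2 * p) e2p /\ W1 ^+ 2 = e2p by move: W1E; rewrite n1f.
    apply/nrm_pmX/(nrm_pm_pos_sqrt f2p c2p W1s).
    by rewrite sqrt_natM rmorphM gs2 gsp mulNr.
  - apply/nrm_pmX/nrm_pm_sqr; rewrite W2s; apply: Qsqrt_fix (fund_Q f2q).
    by rewrite sqrt_natM rmorphM gs2 gsq mulrNN.
  - exact: nrm_pm_expr0.
(* The symmetric argument with [xy], the roles of [p] and [q] being exchanged. *)
have iF : i = false.
  apply/negP=> it; have n1f : n1 = false by apply/negP=> /iE; rewrite it.
  have [c2p W1s] : pos_conj (2 * p) e2p /\ W1 ^+ 2 = e2p by move: W1E; rewrite n1f.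
  have gs2 : xy s2 = - s2 by rewrite /= y2 x2.
  have gsq : xy sq = sq by rewrite /= yq xq.
  have gsp : xy sp = - sp by rewrite /= yp rmorphN /= xp.
  apply: (@pos_sqrt_moved q p e2p W1 xy x) => //.
  - by rewrite eq_sym.
  - apply: Qadjoin_min KW1 => [|v]; first exact: subfield_Qadjoin.
    by rewrite !inE => /or3P[] /eqP->; apply: Qadjoin_gen; rewrite !inE eqxx ?orbT.
  apply: (@norm_fixes xy u' (eqq ^+ c)) => //.
  - by apply/Kx/Ky.
  - by apply: K_invol => //; rewrite ?gs2 ?gsp ?gsq // rmorphN ?gs2 ?gsp opprK.
  - by rewrite exprn_gt0.
  - by rewrite rmorphXn; congr (_ ^+ c); apply: Qsqrt_fix gsq (fund_Q fq).
  rewrite (nrmE xy 1 1 (eqq ^+ 2) 1 (W1 ^+ 2) 1 1).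
  - by congr (_ ^+ 2); rewrite !expr1n it exprAC; ring.
  - exact: nrm_pm_neg f2 c2 gs2.
  - exact: nrm_pm_neg fp cp gsp.
  - exact: nrm_pm_fixed fq gsq.
  - by apply: nrm_pm_neg fpq cpq _; rewrite sqrt_natM rmorphM gsp gsq mulNr.
  - apply/nrm_pmX/nrm_pm_sqr; rewrite W1s; apply: Qsqrt_fix (fund_Q f2p).
    by rewrite sqrt_natM rmorphM gs2 gsp mulrNN.
  - exact: nrm_pm_expr0.
  - exact: nrm_pm_expr0.
exists t, u', a, b, c, d, false; split=> //; first by rewrite mulrC divfK.
by rewrite u2 iF jE kE !expr0; ring.
Qed.

Let W4_unit : K W4 /\ Aunit W4.
Proof.
split; first exact: KW4.
apply: Aunit_sqrt; rewrite W4E; apply: AunitM; last exact: fund_Aunit fpq.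
by apply: AunitM; [exact: fund_Aunit fp | exact: fund_Aunit fq].
Qed.

(** By [sqr_eps_span] the remaining factor [u'] lies in the group generated by [-1], [e2], [ep],
    [eqq], [W4], so it is enough to reduce every unit to such a factor. *)
Lemma units_are_span s :
  (forall v, v \in s -> K v /\ Aunit v) ->
  (forall v, v \in [:: -1; e2; ep; eqq; W1; W2; W3; W4] -> mul_span s v) ->
  (forall u, K u -> Aunit u -> exists t u', [/\ mul_span s t, u = t * u', K u', u' != 0
     & mul_span [:: -1; e2; ep; eqq; epq] (u' ^+ 2)]) ->
  units_are K s.
Proof.
move=> sU sS dec u; split=> [|su].
  case/(unit_groupP _ KF) => Ku /(dec u Ku)[t [u' [st -> Ku' u0' u2]]].
  apply: mul_spanM => //; apply: mul_span_sub (sqr_eps_span Ku' u0' u2) => v vS.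
  by apply: sS; move: vS; rewrite !inE; do 4?[case/orP]; move/eqP->; rewrite eqxx ?orbT.
apply/(unit_groupP _ KF); split.
  by apply: (subfield_span KF) su => v /sU[].
by apply: Aunit_span su => v /sU[].
Qed.

Let Tgens_span s t :
  (forall v, v \in [:: -1; e2; ep; eqq; W1; W2; W3; W4] -> mul_span s v) ->
  mul_span Tgens t -> mul_span s t.
Proof.
move=> sS; apply: mul_span_sub => v; rewrite !inE; do 7?[case/orP]; move/eqP->;
  try by apply: sS; rewrite !inE eqxx ?orbT.
have -> : epq = W4 ^+ 2 / (ep * eqq) by rewrite W4E mulrC mulKf // mulf_neq0 ?nz.
by apply: mul_span_div; [apply: mul_spanX | apply: mul_spanM]; apply: sS; rewrite !inE eqxx ?orbT.
Qed.

(** * The radicand [xi] and the two forms of the unit group *)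

Let xi (a b c d : bool) := e2 ^+ a * ep ^+ b * eqq ^+ c * epq ^+ d * W1 * W2 * W3.

Let xi_gt0 a b c d : 0 < xi a b c d.
Proof. by rewrite !mulr_gt0 ?exprn_gt0. Qed.

Let eps_span a b c d :
  mul_span [:: -1; e2; ep; eqq; epq] (e2 ^+ a * ep ^+ b * eqq ^+ c * epq ^+ d).
Proof.
by do 3?[apply: mul_spanM]; apply: mul_spanX; apply: mul_span_gen; rewrite !inE eqxx ?orbT.
Qed.

Lemma units_no_root :
  (forall a b c d u, n1 && n2 -> K u -> u ^+ 2 <> xi a b c d) ->
  units_are K [:: -1; e2; ep; eqq; W1; W2; W3; W4].
Proof.
move=> no_root; apply: units_are_span => [v||u Ku uU].
- move=> vS; have [->|v4] := eqVneq v W4; first exact: W4_unit.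
  apply: Tgens_unit; move: vS; rewrite !inE (negPf v4) orbF.
  by do 6?[case/orP]; move/eqP->; rewrite eqxx ?orbT.
- by move=> v; apply: mul_span_gen.
have [t [u' [a [b [c [d [e [St [Ku' uU'] uE u2 eE]]]]]]]] := unit_decomp Ku uU.
exists t, u'; split=> //.
- by apply: Tgens_span St => v; apply: mul_span_gen.
- exact: Aunit_neq0.
case: e u2 eE => [u2 /(_ isT) n12|u2 _]; last by rewrite u2 expr0 mulr1.
by case: (no_root a b c d u' n12 Ku'); rewrite u2 /xi expr1 !mulrA.
Qed.

(** The root [X] replaces [W3], which is recovered from [X ^+ 2]. If the product [W1 * W2 * W3]
    occurs in the square of the remaining factor, dividing that factor by [X] cancels it. *)
Lemma units_root a b c d X : K X -> X ^+ 2 = xi a b c d ->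
  units_are K [:: -1; e2; ep; eqq; W1; W2; W4; X].
Proof.
move=> KX X2; set S := [:: -1; _; _; _; _; _; _; _].
have X0 : X != 0 by rewrite -sqrf_eq0 X2 nz.
have XU : Aunit X.
  apply: Aunit_sqrt; rewrite X2 /xi.
  apply: (@Aunit_span Tgens) => [v /Tgens_unit[] //|].
  do 6?[apply: mul_spanM]; try (apply: mul_spanX);
    by apply: mul_span_gen; rewrite !inE eqxx ?orbT.
have SX : mul_span S X by apply: mul_span_gen; rewrite !inE eqxx !orbT.
have Sg v : v \in [:: -1; e2; ep; eqq; W1; W2; W4] -> mul_span S v.
  move=> vS; apply: mul_span_gen; move: vS; rewrite !inE.
  by do 6?[case/orP]; move/eqP->; rewrite eqxx ?orbT.
have Sepq : mul_span S epq.
  have -> : epq = W4 ^+ 2 / (ep * eqq) by rewrite W4E mulrC mulKf // mulf_neq0 ?nz.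
  by apply: mul_span_div; [apply: mul_spanX | apply: mul_spanM]; apply: Sg; rewrite !inE eqxx ?orbT.
have SS v : v \in [:: -1; e2; ep; eqq; W1; W2; W3; W4] -> mul_span S v.
  rewrite !inE; do 7?[case/orP]; move/eqP->; try by apply: Sg; rewrite !inE eqxx ?orbT.
  set D := e2 ^+ a * ep ^+ b * eqq ^+ c * epq ^+ d * W1 * W2.
  have D0 : D != 0 by apply: nz; rewrite !mulr_gt0 ?exprn_gt0.
  have -> : W3 = X ^+ 2 / D by rewrite X2 /xi -/D mulrC mulKf.
  apply: mul_span_div; first exact: mul_spanX.
  by do 5?[apply: mul_spanM]; try (apply: mul_spanX); try exact: Sepq;
    apply: Sg; rewrite !inE eqxx ?orbT.
apply: units_are_span => // [v|u Ku uU].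
  move=> vS; have [->|v4] := eqVneq v W4; first exact: W4_unit.
  have [->|vX] := eqVneq v X; first by [].
  apply: Tgens_unit; move: vS; rewrite !inE (negPf v4) (negPf vX) !orbF.
  by do 5?[case/orP]; move/eqP->; rewrite eqxx ?orbT.
have [t [u' [a' [b' [c' [d' [e [St [Ku' uU'] uE u2 _]]]]]]]] := unit_decomp Ku uU.
have {}St := Tgens_span SS St.
case: e u2 => u2; last first.
  by exists t, u'; split=> //; [apply: Aunit_neq0 | rewrite u2 expr0 mulr1].
exists (t * X), (u' / X); split.
- exact: mul_spanM.
- by rewrite uE -mulrA; congr (_ * _); rewrite mulrC divfK.
- exact: subfield_div.
- by rewrite mulf_neq0 ?invr_eq0 // Aunit_neq0.
set E := e2 ^+ a * ep ^+ b * eqq ^+ c * epq ^+ d.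
set E' := e2 ^+ a' * ep ^+ b' * eqq ^+ c' * epq ^+ d' in u2.
have E0 : E != 0 by apply: nz; rewrite !mulr_gt0 ?exprn_gt0.
have -> : (u' / X) ^+ 2 = E' / E.
  rewrite expr_div_n u2 X2 /xi -/E expr1.
  have [[w1 w2] w3] := (nz W1_gt0, nz W2_gt0, nz W3_gt0).
  by field; rewrite E0 w1 w2 w3.
by apply: mul_span_div; apply: eps_span.
Qed.

(** Under [yz] both [W1] and [W2] have norm [e2] up to sign, so the norm of [X] to [k3] is [D * W3]
    up to sign with [D] in [k3]. Hence [W3] itself lies in [k3]. *)
Lemma root_square_k3 a b c d X : n1 && n2 -> K X -> X ^+ 2 = xi a b c d ->
  is_square_in (Qadjoin [:: s2; sqrt_nat (p * q)]) (e2 * epq * e2pq).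
Proof.
move=> /andP[n1t n2t] KX X2.
have F : subfield_pred (Qadjoin [:: s2; sqrt_nat (p * q)]) by apply: quadF.
have X0 : X != 0 by rewrite -sqrf_eq0 X2 nz.
have g2 : yz s2 = s2 by rewrite /= z2 y2.
have gp : yz sp = - sp by rewrite /= zp yp.
have gq : yz sq = - sq by rewrite /= zq rmorphN /= yq.
have gpq : yz (sqrt_nat (p * q)) = sqrt_nat (p * q) by rewrite sqrt_natM rmorphM gp gq mulrNN.
have g2pq : yz (sqrt_nat (2 * (p * q))) = sqrt_nat (2 * (p * q)).
  by rewrite sqrt_natM rmorphM g2 gpq.
have NE : nrm_pm yz (X ^+ 2) ((e2 ^+ 2) ^+ a * 1 ^+ b * 1 ^+ c * (epq ^+ 2) ^+ d
    * e2 ^+ n1 * e2 ^+ n2 * W3 ^+ 2).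
  rewrite X2; do 6?[apply: nrm_pmM]; try apply: nrm_pmX.
  - exact: nrm_pm_fixed f2 g2.
  - exact: nrm_pm_neg fp cp gp.
  - exact: nrm_pm_neg fq cq gq.
  - exact: nrm_pm_fixed fpq gpq.
  - exact: nrm_pm_line_sqrt f2 fp cp f2p W1E g2 gp.
  - exact: nrm_pm_line_sqrt f2 fq cq f2q W2E g2 gq.
  apply: nrm_pm_sqr; rewrite W3E !rmorphM (Qsqrt_fix g2 (fund_Q f2)).
  by rewrite (Qsqrt_fix gpq (fund_Q fpq)) (Qsqrt_fix g2pq (fund_Q f2pq)).
have Kv := norm_k3 KX; set v := X * yz X in Kv.
have v2 : v ^+ 2 = (e2 ^+ a * epq ^+ d * e2) ^+ 2 * W3 ^+ 2.
  apply: sqr_pos_inj.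
  - apply: K_sqr_gt0; last by rewrite mulf_neq0 ?fmorph_eq0.
    by apply: subfieldM => //; apply/Ky/Kz.
  - by rewrite mulr_gt0 // exprn_gt0 // !mulr_gt0 ?exprn_gt0.
  have -> : v ^+ 2 = nrm yz (X ^+ 2) by rewrite /nrm rmorphXn exprMn.
  rewrite NE n1t n2t !expr1n expr1 [(e2 ^+ 2) ^+ a]exprAC [(epq ^+ 2) ^+ d]exprAC; ring.
set D := _ * e2 in v2.
have kD : Qadjoin [:: s2; sqrt_nat (p * q)] D.
  have k2 : Qadjoin [:: s2; sqrt_nat (p * q)] e2.
    apply: Qadjoin_min (fund_Q f2) => // w; rewrite inE => /eqP->; exact: in_quad1.
  have kpq : Qadjoin [:: s2; sqrt_nat (p * q)] epq.
    apply: Qadjoin_min (fund_Q fpq) => // w; rewrite inE => /eqP->; exact: in_quad2.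
  by do 2?[apply: subfieldM => //]; apply: subfieldX.
have D0 : D != 0 by apply: nz; rewrite !mulr_gt0 ?exprn_gt0.
exists (v / D); first exact: subfield_div.
by rewrite expr_div_n v2 -W3E mulrAC divff ?mul1r // expf_neq0.
Qed.

Let K_sqrtC a b c d u : K u -> u ^+ 2 = xi a b c d -> K (sqrtC (xi a b c d)).
Proof. by move=> Ku u2; apply: (subfield_sqr_root KF Ku); rewrite sqrtCK u2. Qed.

Lemma triquadratic_units :
  let form_a := units_are K [:: -1; e2; ep; eqq; W1; W2; W3; W4] in
  let form_b := exists a b c d : bool, (b, c, d) <> (true, true, true) /\
    units_are K [:: -1; e2; ep; eqq; W1; W2; W4; sqrtC (xi a b c d)] in
  [/\ ~~ (n1 && n2) -> form_a, form_a \/ form_b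
    & n1 && n2 -> form_b ->
      is_square_in (Qadjoin [:: s2; sqrt_nat (p * q)]) (e2 * epq * e2pq)].
Proof.
split=> [/negbTE n12||n12 [a [b [c [d [_ KU]]]]]].
- by apply: units_no_root => a b c d u; rewrite n12.
(* Form (a) or form (b) arises according to whether some [xi a b c d] is a square in [K]. *)
- have [[a [b [c [d [u [Ku u2]]]]]]|no] :=
    classic (exists a b c d u, K u /\ u ^+ 2 = xi a b c d); last first.
    left; apply: units_no_root => a b c d u _ Ku u2.
    by apply: no; exists a, b, c, d, u.
  right; have [bcd|bcd] := eqVneq (b, c, d) (true, true, true); last first.
    exists a, b, c, d; split; first exact/eqP.
    by apply: units_root (K_sqrtC Ku u2) _; rewrite sqrtCK.
  (* Since [W4 ^+ 2 = ep * eqq * epq], dividing the root by [W4] turns the excluded exponents (1, 1,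
     1) into (0, 0, 0). *)
  exists a, false, false, false; split=> //.
  apply: units_root _ (sqrtCK _); apply: (@K_sqrtC _ _ _ _ (u / W4)).
    by apply: subfield_div => //; apply: KW4.
  case: bcd u2 => -> -> -> u2; rewrite expr_div_n u2 W4E /xi !expr0 !expr1.
  by field; rewrite !nz.
apply: (@root_square_k3 a b c d (sqrtC (xi a b c d))) => //; last exact: sqrtCK.
(* The square root is listed among the generators of the unit group, hence lies in [K]. *)
have [//] : K (sqrtC (xi a b c d)) /\ Aunit (sqrtC (xi a b c d)).
by apply/(unit_groupP _ KF)/KU; apply: mul_span_gen; rewrite !inE eqxx !orbT.
Qed.

End Triquadratic.

(** * Square-freeness of the radicands *)

Lemma square_freeP d : (0 < d)%N -> (forall r, prime r -> ~~ (r ^ 2 %| d)%N) -> square_free d.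
Proof.
move=> d0 sf m md; apply/eqP/negPn/negP=> m1.
have m0 : (0 < m)%N.
  by case: m md {m1} => [|//]; rewrite exp0n // dvd0n => /eqP d00; rewrite d00 in d0.
have r_pr : prime (pdiv m) by apply: pdiv_prime; rewrite ltn_neqAle eq_sym m1.
have := sf _ r_pr; rewrite (dvdn_trans _ md) //.
by rewrite dvdn_exp2r ?pdiv_dvd.
Qed.

Lemma square_free_prime p : prime p -> square_free p.
Proof.
move=> p_pr; apply: square_freeP => [|r r_pr]; first exact: prime_gt0.
rewrite pfactor_dvdn ?prime_gt0 // logn_prime //; by case: (r == p).
Qed.

Lemma square_free_coprime m n : (0 < m)%N -> (0 < n)%N -> coprime m n ->
  square_free m -> square_free n -> square_free (m * n).
Proof.
move=> m0 n0 mn sm sn; apply: square_freeP => [|r r_pr]; first by rewrite muln_gt0 m0 n0.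
apply/negP=> rmn.
have r1 : r <> 1%N by move=> r1; rewrite r1 in r_pr.
have [rm|rm] := boolP (r %| m)%N.
  apply: r1; apply: sm; rewrite Gauss_dvdl // in rmn.
  by rewrite coprimeXl // (coprime_dvdl rm).
apply: r1; apply: sn; rewrite Gauss_dvdr // in rmn.
by rewrite coprimeXl // prime_coprime.
Qed.

Theorem theorem4p1 (eps : nat -> algC)
    (heps : forall d : nat, (1 < d)%N -> square_free d ->
              fundamental_unit d (eps d))
    (p1 p2 : nat) (n1 n2 : rat)
    (p1_prime : prime p1) (p2_prime : prime p2) (p1_neq_p2 : p1 <> p2)
    (p1_mod8 : p1 = 1 %[mod 8]) (p2_mod4 : p2 = 1 %[mod 4])
    (Np1p2 : quad_norm (p1 * p2) (eps (p1 * p2)%N) (-1))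
    (N2p1p2 : quad_norm (2 * p1 * p2) (eps (2 * p1 * p2)%N) (-1))
    (hn1 : quad_norm (2 * p1) (eps (2 * p1)%N) n1)
    (hn2 : quad_norm (2 * p2) (eps (2 * p2)%N) n2) :
  let K := Qadjoin [:: sqrt_nat 2; sqrt_nat p1; sqrt_nat p2] in
  let k3 := Qadjoin [:: sqrt_nat 2; sqrt_nat (p1 * p2)] in
  let e2 := eps 2%N in
  let ep1 := eps p1 in
  let ep2 := eps p2 in
  let e2p1 := eps (2 * p1)%N in
  let e2p2 := eps (2 * p2)%N in
  let ep1p2 := eps (p1 * p2)%N in
  let e2p1p2 := eps (2 * p1 * p2)%N in
  let form_a :=
    units_are K
      [:: -1; e2; ep1; ep2;
          sqrtC (e2 * ep1 * e2p1); sqrtC (e2 * ep2 * e2p2);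
          sqrtC (e2 * ep1p2 * e2p1p2); sqrtC (ep1 * ep2 * ep1p2)] in
  let form_b :=
    exists a b c d : bool, (b, c, d) <> (true, true, true) /\
      units_are K
        [:: -1; e2; ep1; ep2;
            sqrtC (e2 * ep1 * e2p1); sqrtC (e2 * ep2 * e2p2);
            sqrtC (ep1 * ep2 * ep1p2);
            sqrtC (e2 ^+ a * ep1 ^+ b * ep2 ^+ c * ep1p2 ^+ d
                   * sqrtC (e2 * ep1 * e2p1) * sqrtC (e2 * ep2 * e2p2)
                   * sqrtC (e2 * ep1p2 * e2p1p2))] in
  [/\ n1 = -1 -> n2 = -1 ->
        (form_a \/ form_b) /\
        (form_b -> is_square_in k3 (e2 * ep1p2 * e2p1p2)),
      n1 = -1 -> n2 = 1 ->
        units_are K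
          [:: -1; e2; ep1; ep2; sqrtC e2p2;
              sqrtC (e2 * ep1 * e2p1); sqrtC (e2 * ep1p2 * e2p1p2);
              sqrtC (ep1 * ep2 * ep1p2)]
    & n1 = 1 -> n2 = 1 ->
        units_are K
          [:: -1; e2; ep1; ep2; sqrtC e2p1; sqrtC e2p2;
              sqrtC (e2 * ep1p2 * e2p1p2); sqrtC (ep1 * ep2 * ep1p2)]].
Proof.
move=> K k3 e2 ep1 ep2 e2p1 e2p2 ep1p2 e2p1p2 form_a form_b.
have p12 : p1 != p2 by apply/eqP.
have p1_mod4 : p1 = 1 %[mod 4] by rewrite -(modn_dvdm p1 (isT : (4 %| 8)%N)) p1_mod8.
have p1_neq2 : p1 != 2%N by apply/eqP=> p1E; move: p1_mod4; rewrite p1E.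
have p2_neq2 : p2 != 2%N by apply/eqP=> p2E; move: p2_mod4; rewrite p2E.
(* The automorphisms [x], [y], [z] flip the square roots of 2, [p1], [p2] respectively and fix the
   other two. *)
have [x [x2 xp xq]] : exists nu : {rmorphism algC -> algC},
    [/\ nu (sqrt_nat 2) = - sqrt_nat 2, nu (sqrt_nat p1) = sqrt_nat p1
      & nu (sqrt_nat p2) = sqrt_nat p2].
  by apply: flip_sqrt_prime => //; rewrite eq_sym.
have [y [yp y2 yq]] := flip_sqrt_prime p1_prime (isT : prime 2) p2_prime p1_neq2 p12.
have p21 : p2 != p1 by rewrite eq_sym.
have [z [zq z2 zp]] := flip_sqrt_prime p2_prime (isT : prime 2) p1_prime p2_neq2 p21.
have sf2 : square_free 2 by apply: square_free_prime.
have sf1 := square_free_prime p1_prime; have sf2' := square_free_prime p2_prime.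
have [g1 g2] := (prime_gt0 p1_prime, prime_gt0 p2_prime).
have cop a b : prime a -> prime b -> a != b -> coprime a b.
  by move=> pa pb ab; rewrite prime_coprime // dvdn_prime2.
have sf12 : square_free (p1 * p2) by apply: square_free_coprime => //; apply: cop.
have gt1 a b : prime a -> (0 < b)%N -> (1 < a * b)%N.
  by move=> pa b0; apply: leq_trans (prime_gt1 pa) _; rewrite leq_pmulr.
have g12 : (0 < p1 * p2)%N by rewrite muln_gt0 g1 g2.
have c21 : coprime 2 p1 by apply: cop => //; rewrite eq_sym.
have c22 : coprime 2 p2 by apply: cop => //; rewrite eq_sym.
have f2 : fundamental_unit 2 e2 by apply: heps.
have fp : fundamental_unit p1 ep1 by apply: heps => //; apply: prime_gt1.
have fq : fundamental_unit p2 ep2 by apply: heps => //; apply: prime_gt1.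
have fpq : fundamental_unit (p1 * p2) ep1p2 by apply: heps => //; apply: gt1.
have f2p : fundamental_unit (2 * p1) e2p1.
  by apply: heps; [apply: gt1 | apply: square_free_coprime].
have f2q : fundamental_unit (2 * p2) e2p2.
  by apply: heps; [apply: gt1 | apply: square_free_coprime].
have f2pq : fundamental_unit (2 * (p1 * p2)) e2p1p2.
  (* Reassociating exhibits the radicand as 2 times [p1 * p2], the shape required by the biquadratic
     field [k3]. *)
  rewrite mulnA; apply: heps; rewrite -mulnA; first exact: gt1.
  by apply: square_free_coprime => //; rewrite coprimeMr c21.
have c2 := fund2_neg x2 f2.
have cp := fund_prime_neg p1_prime p1_mod4 yp fp.
have cq := fund_prime_neg p2_prime p2_mod4 zq fq.
have cpq := quad_norm_neg fpq Np1p2.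
have c2pq : neg_conj (2 * (p1 * p2)) e2p1p2.
  by apply: (quad_norm_neg f2pq); rewrite mulnA.
have rt_gt0 (a : algC) : 0 < a -> 0 < sqrtC a by rewrite sqrtC_gt0.
have P2 := fund_gt0 f2; have Pp := fund_gt0 fp; have Pq := fund_gt0 fq.
have Ppq := fund_gt0 fpq; have P2p := fund_gt0 f2p; have P2q := fund_gt0 f2q.
have P2pq := fund_gt0 f2pq.
have main := triquadratic_units p1_prime p2_prime p12 p1_neq2 p2_neq2 x2 xp xq y2 yp yq
  z2 zp zq f2 fp fq f2p f2q fpq f2pq c2 cp cq cpq c2pq.
have W3p : 0 < sqrtC (e2 * ep1p2 * e2p1p2) by apply: rt_gt0; rewrite !mulr_gt0.
split=> [n1E n2E|n1E n2E|n1E n2E]; rewrite n1E in hn1; rewrite n2E in hn2.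
- have W1p : 0 < sqrtC (e2 * ep1 * e2p1) by apply: rt_gt0; rewrite !mulr_gt0.
  have W2p : 0 < sqrtC (e2 * ep2 * e2p2) by apply: rt_gt0; rewrite !mulr_gt0.
  have [] := main true true _ _ _ _ W1p W2p W3p
    (conj (quad_norm_neg f2p hn1) (sqrtCK _)) (conj (quad_norm_neg f2q hn2) (sqrtCK _))
    (sqrtCK _) (sqrtCK _).
  by move=> _ ab sq; split=> //; apply: sq.
- have W1p : 0 < sqrtC (e2 * ep1 * e2p1) by apply: rt_gt0; rewrite !mulr_gt0.
  have [/(_ isT) Ka _ _] := main true false _ _ _ _ W1p (rt_gt0 _ P2q) W3p
    (conj (quad_norm_neg f2p hn1) (sqrtCK _)) (conj (quad_norm_pos f2q hn2) (sqrtCK _))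
    (sqrtCK _) (sqrtCK _).
  (* The two lists of generators differ only in their order. *)
  move=> u; split=> [/Ka|uS].
    apply: mul_span_sub => v vS; apply: mul_span_gen; move: vS; rewrite !inE.
    by do 7?[case/orP]; move/eqP->; rewrite eqxx ?orbT.
  apply/Ka; apply: mul_span_sub uS => v vS; apply: mul_span_gen; move: vS; rewrite !inE.
  by do 7?[case/orP]; move/eqP->; rewrite eqxx ?orbT.
have [/(_ isT) Ka _ _] := main false false _ _ _ _ (rt_gt0 _ P2p) (rt_gt0 _ P2q) W3p
  (conj (quad_norm_pos f2p hn1) (sqrtCK _)) (conj (quad_norm_pos f2q hn2) (sqrtCK _))
  (sqrtCK _) (sqrtCK _).
exact: Ka.
Qed.
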